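(* For $2c>a$ and $2d>b$ and $x\in(-1,1)$ we have the following two infinite expansions, convergent in mean square: $$h(x|c,d)=h(x|a,b)\sum_{n\ge0}\frac{c_{n,0}(a,b;c,d)}{\hat a_n(a,b)}\,J_n(x|a,b),$$ $$\frac{h(x|c,d)}{h(x|a,b)}=\frac{B(a,b)\,B(c-a+1,d-b+1)}{B(c,d)}\sum_{n\ge0}(2n+1)\,c_{n,0}(1,1;c-a+1,d-b+1)\,J_n(x|1,1).$$
   Context: $a,b,c,d>0$ are the parameters of Beta distributions. $(x)^{(n)}=x(x+1)\cdots(x+n-1)=\Gamma(x+n)/\Gamma(x)$ is the rising factorial; $B$ is Euler's beta function. The Beta density on $[-1,1]$ is $$h(x|a,b)=\frac{(x+1)^{a-1}(1-x)^{b-1}}{B(a,b)\,2^{a+b-1}}\quad(|x|\le1),\qquad h(x|a,b)=0\text{ otherwise},$$ and $$J_n(x|a,b)=\frac1{n!}\sum_{m=0}^n\binom nm(a+b+n-1)^{(m)}(b+m)^{(n-m)}\frac{(x-1)^m}{2^m}$$ are the Jacobi polynomials, orthogonal with respect to $h(\cdot|a,b)$. Moreover $$\hat a_n(a,b)=\int_{-1}^1J_n^2(x|a,b)h(x|a,b)\,dx=\frac{(a)^{(n)}(b)^{(n)}}{n!\,(a+b+2n-1)\,(a+b)^{(n-1)}}\quad(\hat a_0=1),$$ and $$c_{n,0}(a,b;c,d)=\sum_{m=0}^n\frac{(a+b+n-1)^{(m)}(b+m)^{(n-m)}}{m!\,(n-m)!}(-1)^m\frac{(d)^{(m)}}{(c+d)^{(m)}},$$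 which is the coefficient of $J_0(x|c,d)=1$ in the expansion of $J_n(x|a,b)$ in the polynomials $J_j(x|c,d)$, $0\le j\le n$.
   Formalization: The second expansion is stated under the additional conditions 2(c-a+1)>1 and 2(d-b+1)>1, which are exactly what makes h(x|c,d)/h(x|a,b) square integrable on (-1,1); without them its mean-square convergence fails (e.g. a=c=1, b=2, d=1.1). *)

(* Defs.v *)
From mathcomp Require Import all_boot all_order all_algebra.
From mathcomp Require Import all_classical all_reals all_analysis.

Set Implicit Arguments.
Unset Strict Implicit.
Unset Printing Implicit Defensive.
Import Order.TTheory GRing.Theory Num.Theory.
Import numFieldNormedType.Exports.
Local Open Scope classical_set_scope.
Local Open Scope ring_scope.

Definition rising {R : realType} (x : R) (n : nat) : R :=
  \prod_(i < n) (x + i%:R).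

(* Euler's B(a, b) for real a, b > 0 (the library's beta_fun takes natural
   numbers); outside that range the integral diverges and the value is junk. *)
Definition euler_beta {R : realType} (a b : R) : R :=
  \int[lebesgue_measure]_(t in `]0, 1[) (t `^ (a - 1) * (1 - t) `^ (b - 1)).

Definition beta_density {R : realType} (a b x : R) : R :=
  if `|x| <= 1 then
    (x + 1) `^ (a - 1) * (1 - x) `^ (b - 1)
      / (euler_beta a b * 2 `^ (a + b - 1))
  else 0.

(* In the classical notation this is P_n^(b-1, a-1); a = b = 1 is Legendre. *)
Definition jacobi {R : realType} (n : nat) (a b x : R) : R :=
  (n`!%:R)^-1 *
  \sum_(m < n.+1) 'C(n, m)%:R * rising (a + b + n%:R - 1) m
    * rising (b + m%:R) (n - m) * ((x - 1) ^+ m / 2 ^+ m).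

(* Closed form of the squared norm of [jacobi n a b] for the weight
   [beta_density a b].  The case n = 0 is separate because
   the formula would involve the rising factorial of order -1. *)
Definition jacobi_norm2 {R : realType} (n : nat) (a b : R) : R :=
  if n is k.+1 then
    rising a n * rising b n
      / (n`!%:R * (a + b + 2 * n%:R - 1) * rising (a + b) k)
  else 1.

(* The coefficient c_{n,0}(a, b; c, d) of J_0(.|c, d) = 1 in the expansion of
   J_n(.|a, b) along the J_j(.|c, d), j <= n. *)
Definition conn0 {R : realType} (n : nat) (a b c d : R) : R :=
  \sum_(m < n.+1) rising (a + b + n%:R - 1) m * rising (b + m%:R) (n - m)
    / (m`!%:R * (n - m)`!%:R) * (-1) ^+ m * (rising d m / rising (c + d) m).

(* f = \sum_n u n on ]-1, 1[, in mean square for the nonnegative weight w: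
   convergence of the partial sums to f in L^2(]-1, 1[, w dx).  The integral is
   extended-real valued, so the limit 0 includes f - \sum_(n < N) u n being
   square integrable for N large. *)
Definition mean_square_sum {R : realType} (w : R -> R) (u : nat -> R -> R)
    (f : R -> R) : Prop :=
  (fun N : nat => (\int[lebesgue_measure]_(x in `](-1)%R, 1%R[)
     ((f x - \sum_(n < N) u n x) ^+ 2 * w x)%R%:E)%E) @ \oo --> (0 : \bar R)%E.

(* Main.v *)
Require Import Defs.
From HB Require Import structures.
From mathcomp Require Import all_boot all_order all_algebra.
From mathcomp Require Import all_classical all_reals all_analysis.
From mathcomp Require Import archimedean measurable_realfun ring lra.
Import Order.TTheory GRing.Theory Num.Theory.
Import numFieldNormedType.Exports.
Local Open Scope classical_set_scope.
Local Open Scope ring_scope.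
Set Implicit Arguments.
Unset Strict Implicit.
Unset Printing Implicit Defensive.

(* In the variable t = (1 - x) / 2 the moments of h(.|a, b) are
   (b)^(i) / (a + b)^(i), by the recursion B(a, b + 1) = b / (a + b) B(a, b).
   The orthogonality and the norms of the J_n therefore reduce to n-th finite
   differences of rational functions, and c_{n,0} is the integral of
   J_n(.|a, b) against h(.|c, d), i.e. the n-th Fourier coefficient of
   f = h(.|c, d) / h(.|a, b) in L^2(h(.|a, b)) before normalization.  The
   conditions a < 2 c and b < 2 d say exactly that f is square integrable.
   The partial sums are then the best approximations of f by polynomials of
   bounded degree, and polynomials approximate f in mean square: truncate f at
   height k, then take Bernstein polynomials, with dominated convergence at both
   steps.  The second expansion is k times the first one for the parameters
   (1, 1; c - a + 1, d - b + 1), for a constant k. *)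

(** * Rising factorials and finite differences *)

Lemma rising0 (R : realType) (x : R) : rising x 0 = 1.
Proof. by rewrite /rising big_ord0. Qed.

Lemma risingSr (R : realType) (x : R) n :
  rising x n.+1 = rising x n * (x + n%:R).
Proof. by rewrite /rising big_ord_recr. Qed.

Lemma risingD (R : realType) (x : R) m n :
  rising x (m + n) = rising x m * rising (x + m%:R) n.
Proof.
elim: n => [|n IH]; first by rewrite addn0 rising0 mulr1.
by rewrite addnS !risingSr IH natrD; ring.
Qed.

Lemma risingS (R : realType) (x : R) n :
  rising x n.+1 = x * rising (x + 1) n.
Proof. by rewrite -add1n risingD risingSr rising0 addr0 mul1r. Qed.

Lemma rising_gt0 (R : realType) (x : R) n : 0 < x -> 0 < rising x n.
Proof.
move=> x0; elim: n => [|n IH]; first by rewrite rising0.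
by rewrite risingSr mulr_gt0// ltr_wpDr.
Qed.

(** Reflection: reverse the order of the factors and change all their signs. It evaluates the
    residue in [jacobi_moment_diag]. *)
Lemma rising_neg (R : realType) (x : R) n :
  rising (- x - n%:R + 1) n = (-1) ^+ n * rising x n.
Proof.
elim: n => [|n IH]; first by rewrite !rising0 mulr1.
rewrite risingS risingSr exprS.
have -> : - x - n.+1%:R + 1 + 1 = - x - n%:R + 1 :> R by rewrite -natr1; ring.
by rewrite IH -natr1; ring.
Qed.

(** Pascal's rule. Up to sign the left side is the $(n+1)$-st finite difference of $g$ at 0, written
    as an $n$-th difference of a first difference. *)
Lemma sum_alt_binS (R : realType) (g : nat -> R) n :
  \sum_(m < n.+2) (-1) ^+ m * 'C(n.+1, m)%:R * g m =
  \sum_(m < n.+1) (-1) ^+ m * 'C(n, m)%:R * (g m - g m.+1).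
Proof.
rewrite big_ord_recl /= expr0 bin0 !mul1r.
under eq_bigr do rewrite /bump /= add1n binS natrD mulrDr mulrDl.
rewrite big_split /=.
under [in RHS]eq_bigr do rewrite mulrBr.
rewrite sumrB addrA; congr (_ + _).
  rewrite big_ord_recr /= bin_small// mulr0 mul0r addr0.
  rewrite [RHS]big_ord_recl /= expr0 bin0 !mul1r; congr (_ + _).
rewrite -sumrN; apply: eq_bigr => i _; rewrite exprS; ring.
Qed.

(** Each difference lowers the degree by at least one, so $n$ of them kill a polynomial of degree
    less than $n$. *)
Lemma sum_alt_bin_poly (R : realType) (q : {poly R}) n : (size q <= n)%N ->
  \sum_(m < n.+1) (-1) ^+ m * 'C(n, m)%:R * q.[m%:R] = 0.
Proof.
elim: n q => [|n IH] q.
  rewrite leqn0 size_poly_eq0 => /eqP ->.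
  by rewrite big1// => i _; rewrite horner0 mulr0.
move=> sq; rewrite (sum_alt_binS (fun m : nat => q.[m%:R])).
have := IH (q - (q \Po ('X + 1))).
(* $q$ and its translate have the same size and the same leading coefficient, so the top terms
   cancel. *)
have -> : (size (q - (q \Po ('X + 1)))%R <= n)%N.
  have [->|q0] := eqVneq q 0; first by rewrite comp_poly0 subrr size_poly0.
  have sqX : size ('X + 1 : {poly R}) = 2%N by rewrite -[1]/(1%:P) size_XaddC.
  rewrite -ltnS (leq_trans _ sq)//.
  have sc : size (q \Po ('X + 1)) = size q by rewrite size_comp_poly2.
  have s0 : (0 < size q)%N by rewrite size_poly_gt0.
  have lc : lead_coef (q \Po ('X + 1)) = lead_coef q.
    by rewrite lead_coef_comp ?sqX// -[1]/(1%:P) lead_coefXaddC expr1n mulr1.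
  rewrite -(prednK s0) ltnS; apply/leq_sizeP => j.
  rewrite leq_eqVlt => /predU1P[<-|qj].
    by rewrite coefB -{1}lead_coefE -sc -lead_coefE lc subrr.
  rewrite coefB !nth_default ?subrr// ?sc -(prednK s0)//.
move=> /(_ isT) IHq; rewrite -[RHS]IHq; apply: eq_bigr => i _.
by rewrite !hornerE horner_comp !hornerE natr1.
Qed.

(** The first difference of $1/(y+m)$ involves the same function at $y$ and $y+1$; hence the
    induction is on $n$ for all $y$. *)
Lemma sum_alt_bin_inv (R : realType) (y : R) n : 0 < y ->
  \sum_(m < n.+1) (-1) ^+ m * 'C(n, m)%:R * (y + m%:R)^-1
  = n`!%:R / rising y n.+1.
Proof.
elim: n y => [|n IH] y y0.
  by rewrite big_ord1 risingS rising0 addr0 mulr1 !mul1r.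
rewrite (sum_alt_binS (fun m : nat => (y + m%:R)^-1)).
under eq_bigr do rewrite mulrBr -natr1 addrA addrAC.
rewrite sumrB IH// IH; last by rewrite ltr_wpDr.
have y1 : y + 1 != 0 by rewrite gt_eqF// ltr_wpDr.
rewrite [rising y n.+1]risingS [rising y n.+2]risingS.
rewrite [rising (y + 1) n.+1]risingSr factS natrM.
have r0 : rising (y + 1) n != 0 by rewrite gt_eqF// rising_gt0// ltr_wpDr.
have yn : y + 1 + n%:R != 0 by rewrite gt_eqF// ltr_wpDr// ltr_wpDr.
rewrite -natr1; field.
by rewrite yn r0 gt_eqF.
Qed.

(** * Orthogonality of the Jacobi polynomials *)

(** A polynomial in the shift of the base point, so that summands such as $(b+m)^{(k)}$ become
    values at $m$ to which [sum_alt_bin_poly] applies. *)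
Definition rising_poly (R : realType) (x : R) n : {poly R} :=
  \prod_(i < n) ('X + (x + i%:R)%:P).

Lemma horner_rising_poly (R : realType) (x y : R) n :
  (rising_poly x n).[y] = rising (x + y) n.
Proof.
rewrite horner_prod; apply: eq_bigr => i _.
rewrite hornerD hornerX hornerC; ring.
Qed.

Lemma size_rising_poly (R : realType) (x : R) n :
  (size (rising_poly x n) <= n.+1)%N.
Proof.
elim: n => [|n IH]; first by rewrite /rising_poly big_ord0 size_poly1.
rewrite /rising_poly big_ord_recr /= (leq_trans (size_polyMleq _ _))//.
by rewrite size_XaddC addn2 /= ltnS.
Qed.

(* [moment_fun a b p] is the integral of p((1 - x) / 2) h(x|a, b). *)
Definition beta_moment (R : realType) (a b : R) i :=
  rising b i / rising (a + b) i.

Definition moment_fun (R : realType) (a b : R) (p : {poly R}) : R :=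
  \sum_(i < size p) p`_i * beta_moment a b i.

Section moment_fun.
Context {R : realType}.
Implicit Types (a b c d : R) (p q : {poly R}).

Lemma moment_funE a b p n : (size p <= n)%N ->
  moment_fun a b p = \sum_(i < n) p`_i * beta_moment a b i.
Proof.
move=> pn; rewrite /moment_fun (big_ord_widen n
  (fun i => p`_i * beta_moment a b i) pn).
rewrite [RHS](bigID (fun i : 'I_n => (i < size p)%N)) /=.
rewrite [X in _ = _ + X]big1 ?addr0// => i.
by rewrite -leqNgt => pi; rewrite nth_default ?mul0r.
Qed.

Fact moment_fun_is_linear a b : scalar (moment_fun a b).
Proof.
move=> k p q; set n := maxn (size p) (size q).
rewrite !(@moment_funE a b _ n) ?leq_maxl ?leq_maxr//; last first.
  rewrite (leq_trans (size_polyD _ _))// geq_max leq_maxr andbT.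
  by rewrite (leq_trans (size_scale_leq _ _)) ?leq_maxl.
rewrite mulr_sumr -big_split; apply: eq_bigr => i _ /=.
by rewrite coefD coefZ mulrDl mulrA.
Qed.

HB.instance Definition _ a b :=
  GRing.isLinear.Build R {poly R} R *%R (moment_fun a b)
    (moment_fun_is_linear a b).

Lemma moment_funXn a b n : moment_fun a b 'X^n = beta_moment a b n.
Proof.
rewrite /moment_fun size_polyXn big_ord_recr /= coefXn eqxx mul1r.
by rewrite big1 ?add0r// => i _; rewrite coefXn ltn_eqF// mul0r.
Qed.

(** The sign comes from $(x-1)/2 = -t$ with $t = (1-x)/2$. *)
Definition jacobi_coef n a b m : R :=
  (n`!%:R)^-1 * ('C(n, m)%:R * rising (a + b + n%:R - 1) m
    * rising (b + m%:R) (n - m) * (-1) ^+ m).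

(* [jacobi n a b] as a polynomial in (1 - x) / 2. *)
Definition jacobi_poly n a b : {poly R} := \poly_(m < n.+1) jacobi_coef n a b m.

Lemma jacobiE n a b x : jacobi n a b x = (jacobi_poly n a b).[(1 - x) / 2].
Proof.
rewrite horner_poly /jacobi mulr_sumr; apply: eq_bigr => m _.
rewrite /jacobi_coef -[_ ^+ m / _]expr_div_n -(opprB 1 x) mulNr.
by rewrite [(- (_ / _)) ^+ _]exprNn; ring.
Qed.

Lemma size_jacobi_poly n a b : (size (jacobi_poly n a b) <= n.+1)%N.
Proof. exact: size_poly. Qed.

Lemma lead_jacobi_poly n a b :
  (jacobi_poly n a b)`_n =
  (n`!%:R)^-1 * (rising (a + b + n%:R - 1) n * (-1) ^+ n).
Proof.
by rewrite coef_poly ltnSn /jacobi_coef binn mul1r subnn rising0 mulr1.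
Qed.

(** This gives $c_{n,0}$ its role as an unnormalized Fourier coefficient. The factorials match
    because $\binom nm / n! = 1/(m!\,(n-m)!)$. *)
Lemma moment_fun_jacobi n a b c d :
  moment_fun c d (jacobi_poly n a b) = conn0 n a b c d.
Proof.
rewrite (moment_funE _ _ (size_jacobi_poly n a b)); apply: eq_bigr => m _.
rewrite coef_poly ltn_ord /jacobi_coef /beta_moment.
have mn : (m <= n)%N by rewrite -ltnS.
rewrite -(bin_fact mn) !natrM.
have f0 k : k`!%:R != 0 :> R by rewrite pnatr_eq0 -lt0n fact_gt0.
have C0 : 'C(n, m)%:R != 0 :> R by rewrite pnatr_eq0 -lt0n bin_gt0.
set r := rising d m / _; field.
by rewrite C0 !f0.
Qed.

Lemma moment_fun_jacobiM n a b k :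
  moment_fun a b (jacobi_poly n a b * 'X^k) =
  \sum_(m < n.+1) jacobi_coef n a b m * beta_moment a b (m + k).
Proof.
rewrite /jacobi_poly poly_def mulr_suml linear_sum; apply: eq_bigr => m _.
by rewrite -scalerAl -exprD linearZ /= moment_funXn.
Qed.

Section orthogonality.
Context (a b : R) (a0 : 0 < a) (b0 : 0 < b).

Let s0 : 0 < a + b. Proof. exact: addr_gt0. Qed.

Let rs0 n : rising (a + b) n != 0. Proof. by rewrite gt_eqF// rising_gt0. Qed.

(** Everything independent of $m$ is pulled out: $(b)^{(m)}(b+m)^{(n+1-m)}$ is constant, and
    $(a+b+n)^{(m)}$ is $(a+b)^{(n+m)}$ over a constant. What is left is a finite difference. *)
Let jacobi_moment_term n (m : 'I_n.+2) k :
  jacobi_coef n.+1 a b m * beta_moment a b (m + k) =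
  rising b n.+1 / (n.+1`!%:R * rising (a + b) n) *
  ((-1) ^+ m * 'C(n.+1, m)%:R * (rising (b + m%:R) k *
    (rising (a + b) (n + m) / rising (a + b) (m + k)))).
Proof.
rewrite /jacobi_coef /beta_moment (risingD b m k) (risingD (a + b) n m).
have -> : rising b n.+1 = rising b m * rising (b + m%:R) (n.+1 - m).
  by rewrite -risingD subnKC// -ltnS.
have -> : a + b + n.+1%:R - 1 = a + b + n%:R by rewrite -natr1; ring.
have f0 : n.+1`!%:R != 0 :> R by rewrite pnatr_eq0 -lt0n fact_gt0.
by field; rewrite f0 !rs0.
Qed.

(* The sum is an n-th difference of a polynomial in m of degree n - 1. *)
Lemma jacobi_moment_eq0 n k : (k < n)%N ->
  moment_fun a b (jacobi_poly n a b * 'X^k) = 0.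
Proof.
case: n => // n; rewrite ltnS => kn; rewrite moment_fun_jacobiM.
under eq_bigr do rewrite jacobi_moment_term.
rewrite -mulr_sumr.
(* For $k \le n$ the quotient of rising factorials in $a+b$ is a polynomial in $m$ of degree $n-k$;
   the total degree is $n$, one less than the order of the difference. *)
pose q := rising_poly b k * rising_poly (a + b + k%:R) (n - k).
have sq : (size q <= n.+1)%N.
  rewrite (leq_trans (size_polyMleq _ _))//.
  have := leq_add (size_rising_poly b k)
    (size_rising_poly (a + b + k%:R) (n - k)).
  rewrite addSn addnS subnKC// => h.
  by rewrite -subn1 leq_subLR add1n.
rewrite (_ : \sum_(_ < _) _ = 0) ?mulr0//.
rewrite -[RHS](sum_alt_bin_poly sq); apply: eq_bigr => m _; congr (_ * _).
rewrite hornerM !horner_rising_poly; congr (_ * _).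
have -> : (n + m = m + k + (n - k))%N by rewrite -addnA subnKC// addnC.
rewrite risingD mulrAC divff// mul1r natrD.
by congr rising; ring.
Qed.

(* Here the summand is a rational function of m with the single pole - y; only
   the fractional part r / (y + m) contributes. *)
Lemma jacobi_moment_diag n :
  moment_fun a b (jacobi_poly n.+1 a b * 'X^(n.+1)) =
  rising b n.+1 / rising (a + b) n * ((-1) ^+ n.+1 * rising a n.+1)
  / rising (a + b + n%:R) n.+2.
Proof.
rewrite moment_fun_jacobiM.
under eq_bigr do rewrite jacobi_moment_term.
rewrite -mulr_sumr.
pose y := a + b + n%:R.
have y0 : 0 < y by rewrite ltr_wpDr.
pose r := (rising_poly b n.+1).[- y].
(* Division by $X + y$: the quotient has degree at most $n$, so the $(n+1)$-st difference kills
   it. *)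
have [q qE] : exists q, rising_poly b n.+1 - r%:P = q * ('X - (- y)%:P).
  by apply/factor_theorem; rewrite /root hornerD hornerN hornerC subrr.
have sq : (size q <= n.+1)%N.
  have [->|q0] := eqVneq q 0; first by rewrite size_poly0.
  have : (size (rising_poly b n.+1 - r%:P)%R <= n.+2)%N.
    rewrite (leq_trans (size_polyD _ _))// geq_max size_rising_poly.
    by rewrite size_polyN (leq_trans (size_polyC_leq1 _)).
  by rewrite qE size_Mmonic ?monicXsubC// size_XsubC addn2.
have -> : \sum_(m < n.+2) (-1) ^+ m * 'C(n.+1, m)%:R * (rising (b + m%:R) n.+1 *
    (rising (a + b) (n + m) / rising (a + b) (m + n.+1))) =
   r * (n.+1`!%:R / rising y n.+2).
  rewrite -sum_alt_bin_inv// mulr_sumr.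
  rewrite -[RHS]addr0 -[X in _ = _ + X](sum_alt_bin_poly sq) -big_split /=.
  apply: eq_bigr => m _.
  have ym : y + m%:R != 0 by rewrite gt_eqF// ltr_wpDr.
  have -> : rising (b + m%:R) n.+1 = r + q.[m%:R] * (y + m%:R).
    have := congr1 (fun p => p.[m%:R]) qE.
    rewrite hornerD hornerN hornerM horner_rising_poly !hornerE /= opprK.
    by rewrite [m%:R + y]addrC => <-; ring.
  rewrite addnS [(m + n)%N]addnC risingSr natrD addrA -/y.
  by field; rewrite ym rs0.
(* Since $b - y = -a-n$, reflection applies and produces the factor $(a)^{(n+1)}$ of the norm. *)
have -> : r = (-1) ^+ n.+1 * rising a n.+1.
  rewrite /r horner_rising_poly -rising_neg; congr rising.
  by rewrite /y -natr1; ring.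
have f0 : n.+1`!%:R != 0 :> R by rewrite pnatr_eq0 -lt0n fact_gt0.
by rewrite -/y; field; rewrite f0 rs0 gt_eqF// rising_gt0.
Qed.

Lemma jacobi_norm2_gt0 n : 0 < jacobi_norm2 n a b.
Proof.
case: n => // n; rewrite /jacobi_norm2 divr_gt0 ?mulr_gt0 ?rising_gt0//.
have : 0 <= n%:R :> R by []. rewrite -natr1; move: a0 b0; lra.
Qed.

(** $J_n$ is orthogonal to all lower powers, so only the top coefficient of $q$ contributes. Both
    the norm and the mutual orthogonality are instances. *)
Lemma moment_fun_jacobi_mul n q : (size q <= n.+1)%N ->
  moment_fun a b (jacobi_poly n a b * q) =
  q`_n / (jacobi_poly n a b)`_n * jacobi_norm2 n a b.
Proof.
move=> sq.
have -> : q = \poly_(i < n.+1) q`_i.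
  apply/polyP => i; rewrite coef_poly; case: ltnP => // ni.
  by rewrite nth_default// (leq_trans sq).
rewrite coef_poly ltnSn poly_def mulr_sumr linear_sum big_ord_recr /=.
rewrite big1 ?add0r => [|i _]; last first.
  by rewrite -scalerAr linearZ /= jacobi_moment_eq0// mulr0.
rewrite -scalerAr linearZ /= -mulrA; congr (_ * _).
case: n {sq} => [|n].
  rewrite mulr1 moment_fun_jacobi /conn0 lead_jacobi_poly big_ord1.
  by rewrite !rising0 !fact0 !expr0 !mulr1 !invr1 !mulr1.
rewrite jacobi_moment_diag lead_jacobi_poly /jacobi_norm2.
have f0 : n.+1`!%:R != 0 :> R by rewrite pnatr_eq0 -lt0n fact_gt0.
have -> : a + b + n.+1%:R - 1 = a + b + n%:R by rewrite -natr1; ring.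
rewrite (risingSr _ n.+1).
have y0 : 0 < a + b + n%:R by rewrite ltr_wpDr.
have -> : a + b + n%:R + n.+1%:R = a + b + 2 * n.+1%:R - 1.
  by rewrite -natr1; ring.
have z0 : a + b + 2 * n.+1%:R - 1 != 0.
  rewrite gt_eqF//; have : 0 <= n%:R :> R by [].
  rewrite -natr1; move: a0 b0; lra.
have ry0 : rising (a + b + n%:R) n.+1 != 0 by rewrite gt_eqF// rising_gt0.
have e2 : (-1) ^+ n.+1 * (-1) ^+ n.+1 = 1 :> R.
  by rewrite -expr2 sqrr_sign.
have e0 : (-1) ^+ n.+1 != 0 :> R by rewrite signr_eq0.
set e := (-1) ^+ n.+1 in e2 e0 *; set z := a + b + 2 * _ - 1 in z0 *.
set y := rising (a + b + n%:R) n.+1 in ry0 *.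
(* [field] sees the sign $e$ as an atom; the relation $e^2 = 1$ has to be inserted by hand. *)
rewrite -[RHS]mul1r -e2.
by field; rewrite f0 e0 z0 ry0 rs0.
Qed.

Lemma lead_jacobi_poly_neq0 n : (jacobi_poly n a b)`_n != 0.
Proof.
rewrite lead_jacobi_poly mulf_neq0 ?invr_neq0 ?pnatr_eq0 -?lt0n ?fact_gt0//.
rewrite mulf_neq0 ?signr_eq0//; case: n => [|n];
  first by rewrite rising0 oner_eq0.
rewrite gt_eqF// rising_gt0// -natr1.
have : 0 <= n%:R :> R by []. move: a0 b0; lra.
Qed.

Lemma moment_fun_jacobi_sqr n :
  moment_fun a b (jacobi_poly n a b * jacobi_poly n a b) = jacobi_norm2 n a b.
Proof.
rewrite moment_fun_jacobi_mul ?size_jacobi_poly// divff ?mul1r//.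
exact: lead_jacobi_poly_neq0.
Qed.

Lemma moment_fun_jacobi_orth m n : m != n ->
  moment_fun a b (jacobi_poly m a b * jacobi_poly n a b) = 0.
Proof.
wlog mn : m n / (n < m)%N => [h|_].
  rewrite neq_ltn => /orP[|] mn; first by rewrite mulrC h// gtn_eqF.
  by rewrite h// gtn_eqF.
rewrite moment_fun_jacobi_mul ?(leq_trans (size_jacobi_poly _ _ _)) 1?ltnW//.
by rewrite nth_default ?mul0r// (leq_trans (size_jacobi_poly _ _ _)).
Qed.

(** * Partial sums as orthogonal projections *)

Context (c d : R).

(** The $N$-th partial sum of the first expansion, as a polynomial in $(1-x)/2$. *)
Definition jacobi_sum N : {poly R} :=
  \sum_(n < N) (conn0 n a b c d / jacobi_norm2 n a b) *: jacobi_poly n a b.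

Lemma size_jacobi_sum N : (size (jacobi_sum N) <= N)%N.
Proof.
apply: (leq_trans (size_sum _ _ _)); apply/bigmax_leqP => i _.
rewrite (leq_trans (size_scale_leq _ _))// (leq_trans (size_jacobi_poly _ _
  _))//.
Qed.

(** Among polynomials of size at most $N$, the partial sum represents integration against
    $h(\cdot|c,d)$; it is thus the projection of the density quotient. It suffices to test on
    $J_0,\dots,J_{N-1}$, which the induction does by splitting off the top degree. *)
Lemma moment_fun_jacobi_sum N q : (size q <= N)%N ->
  moment_fun a b (jacobi_sum N * q) = moment_fun c d q.
Proof.
suff h k : (k <= N)%N -> (size q <= k)%N ->
    moment_fun a b (jacobi_sum N * q) = moment_fun c d q by exact: h.
elim: k q => [q _|k IH q kN sq].
  by rewrite leqn0 size_poly_eq0 => /eqP ->; rewrite mulr0 !linear0.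
(* Chosen so that subtracting $l J_k$ cancels the coefficient of degree $k$. *)
pose l := q`_k / (jacobi_poly k a b)`_k.
have [r [-> sr]] : exists r, q = r + l *: jacobi_poly k a b /\ (size r <= k)%N.
  exists (q - l *: jacobi_poly k a b); split; first by rewrite subrK.
  apply/leq_sizeP => j; rewrite leq_eqVlt => /predU1P[<-|kj].
    by rewrite coefB coefZ /l divfK ?subrr// lead_jacobi_poly_neq0.
  rewrite coefB coefZ !nth_default ?mulr0 ?subrr//.
  + exact: leq_trans (size_jacobi_poly _ _ _) _.
  + exact: leq_trans sq _.
rewrite mulrDr !linearD /= (IH _ (ltnW kN) sr).
congr (_ + _); rewrite -scalerAr !linearZ /=; congr (_ * _).
rewrite /jacobi_sum mulr_suml linear_sum (bigD1 (Ordinal kN))//= big1 => [|i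
  ik].
  rewrite addr0 -scalerAl linearZ /= moment_fun_jacobi_sqr divfK.
    by rewrite moment_fun_jacobi.
  by rewrite gt_eqF// jacobi_norm2_gt0.
by rewrite -scalerAl linearZ /= moment_fun_jacobi_orth ?mulr0.
Qed.

End orthogonality.

(* [moment_fun a b (p ^+ 2) - 2 * moment_fun c d p] is the mean square distance
   of p to h(.|c, d) / h(.|a, b), up to a constant. *)
Lemma moment_fun_jacobi_sum_sub a b c d N p : 0 < a -> 0 < b ->
  (size p <= N)%N -> let S := jacobi_sum a b c d N in
  moment_fun a b (p ^+ 2) - 2 * moment_fun c d p
  - (moment_fun a b (S ^+ 2) - 2 * moment_fun c d S)
  = moment_fun a b ((p - S) ^+ 2).
Proof.
move=> a0 b0 sp S; rewrite sqrrB [in RHS]linearD [in RHS]linearB /= raddfMn /=.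
rewrite -[p * S]mulrC (moment_fun_jacobi_sum a0 b0 c d sp).
rewrite [S ^+ 2]expr2 (moment_fun_jacobi_sum a0 b0 c d (size_jacobi_sum _ _ _ _
  _)).
ring.
Qed.

End moment_fun.

(** * Improper integrals on open intervals *)

Section exhaustion.
Context {R : realType}.
Notation mu := (@lebesgue_measure R).
Implicit Types (p q : R) (n : nat).

(** With [n.+3] each end moves in by at most a third of the length, so the interval is nondegenerate
    already for $n = 0$. *)
Definition inner_itv p q n : set R :=
  `[p + (q - p) * n.+3%:R^-1, q - (q - p) * n.+3%:R^-1]%classic.

Lemma inner_itv_bounds p q n : p < q ->
  [/\ p < p + (q - p) * n.+3%:R^-1,
      p + (q - p) * n.+3%:R^-1 < q - (q - p) * n.+3%:R^-1 &
      q - (q - p) * n.+3%:R^-1 < q].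
Proof.
move=> pq; have qp : 0 < q - p by rewrite subr_gt0.
have e0 : 0 < n.+3%:R^-1 :> R by rewrite invr_gt0.
have e3 : n.+3%:R^-1 <= 3^-1 :> R by rewrite lef_pV2 ?posrE// ler_nat.
have h1 : 0 < (q - p) * n.+3%:R^-1 by rewrite mulr_gt0.
have h2 : (q - p) * n.+3%:R^-1 <= (q - p) * 3^-1 by rewrite ler_pM2l.
by move: h1 h2; set u := _ * n.+3%:R^-1 => h1 h2; split; lra.
Qed.

Lemma inner_itv_sub p q n : p < q -> inner_itv p q n `<=` `]p, q[%classic.
Proof.
move=> pq x; have [h1 _ h3] := inner_itv_bounds n pq.
rewrite /inner_itv /= !in_itv /= => /andP[px xq].
by rewrite (lt_le_trans h1)//= (le_lt_trans xq).
Qed.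

Lemma bigcup_inner_itv p q : p < q ->
  \bigcup_n inner_itv p q n = `]p, q[%classic.
Proof.
move=> pq; have qp : 0 < q - p by rewrite subr_gt0.
apply/seteqP; split => [x [n _]|x]; first exact: inner_itv_sub.
rewrite /= in_itv /= => /andP[px xq].
(* The relative distance of $x$ to the nearer end; any $n$ with $1/(n+3) \le d$ will do. *)
pose d := Num.min (x - p) (q - x) / (q - p).
have d0 : 0 < d by rewrite divr_gt0// lt_min !subr_gt0 px xq.
exists (Num.truncn d^-1) => //.
have nd : (Num.truncn d^-1).+3%:R^-1 <= d.
  rewrite -[leRHS]invrK lef_pV2 ?posrE ?invr_gt0//.
  by rewrite (le_trans (ltW (truncnS_gt _)))// ler_nat ltnS -addn2 leq_addr.
have : (q - p) * (Num.truncn d^-1).+3%:R^-1 <= Num.min (x - p) (q - x).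
  by rewrite mulrC -ler_pdivlMr.
rewrite /inner_itv /= in_itv /= le_min => /andP[h1 h2].
by move: h1 h2; set u := _ * _.+3%:R^-1 => h1 h2; apply/andP; split; lra.
Qed.

(** Monotone convergence along an increasing exhaustion by compact intervals. *)
Lemma ge0_cvg_inner_itv p q (f : R -> R) : p < q ->
  measurable_fun `]p, q[ f -> (forall x, p < x < q -> 0 <= f x) ->
  (\int[mu]_(x in inner_itv p q n) (f x)%:E @[n --> \oo] -->
   \int[mu]_(x in `]p, q[) (f x)%:E)%E.
Proof.
move=> pq mf f0; rewrite -(bigcup_inner_itv pq).
apply: ge0_nondecreasing_set_cvg_integral.
- move=> m n mn; rewrite subsetEset => x; rewrite /inner_itv /= !in_itv /=.
  have : n.+3%:R^-1 <= m.+3%:R^-1 :> R by rewrite lef_pV2 ?posrE// ler_nat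
    !ltnS.
  have qp : 0 < q - p by rewrite subr_gt0.
  move=> h /andP[h1 h2].
  have {h} : (q - p) * n.+3%:R^-1 <= (q - p) * m.+3%:R^-1 by rewrite ler_pM2l.
  move: h1 h2; set u := _ * m.+3%:R^-1; set v := _ * n.+3%:R^-1 => h1 h2 uv.
  by apply/andP; split; lra.
- by move=> n; exact: measurable_itv.
- move=> n; apply/measurable_EFinP; apply: measurable_funS mf => //.
  exact: inner_itv_sub.
- move=> n x /(inner_itv_sub pq); rewrite /= in_itv /= => pxq.
  by rewrite lee_fin f0.
Qed.

Lemma FTC2_closed_sub p q a b (f F : R -> R) : p < a -> a < b -> b < q ->
  (forall x, p < x < q -> {for x, continuous f}) ->
  (forall x, p < x < q -> is_derive x 1 F (f x)) ->
  (\int[mu]_(x in `[a, b]) (f x)%:E = (F b - F a)%:E)%E.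
Proof.
move=> pa ab bq cf dF.
have sub x : a <= x <= b -> p < x < q.
  by move=> /andP[ax xb]; rewrite (lt_le_trans pa)//= (le_lt_trans xb).
have cF x : a <= x <= b -> {for x, continuous F}.
  move=> /sub h; have := dF _ h => ?.
  exact/differentiable_continuous/derivable1_diffP.
rewrite (@continuous_FTC2 _ f F)//.
- apply: continuous_in_subspaceT => x; rewrite inE /= in_itv /= => h.
  exact/cf/sub.
- split.
  + move=> x; rewrite in_itv /= => /andP[ax xb].
    by have [] := dF x (sub x _); rewrite ?(ltW ax) ?(ltW xb).
  + by apply: cvg_at_right_filter; apply: cF; rewrite lexx ltW.
  + by apply: cvg_at_left_filter; apply: cF; rewrite lexx ltW.
- move=> x; rewrite in_itv /= => /andP[ax xb]; rewrite derive1E.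
  by have [] := dF x (sub x _); rewrite ?(ltW ax) ?(ltW xb).
Qed.

(** Improper form for integrands that may blow up at the ends: the fundamental theorem on each inner
    interval, then the limit, which nonnegativity justifies. *)
Lemma ge0_FTC2_oo p q (f F : R -> R) A B : p < q ->
  (forall x, p < x < q -> 0 <= f x) ->
  (forall x, p < x < q -> {for x, continuous f}) ->
  (forall x, p < x < q -> is_derive x 1 F (f x)) ->
  F (p + (q - p) * n.+3%:R^-1) @[n --> \oo] --> A ->
  F (q - (q - p) * n.+3%:R^-1) @[n --> \oo] --> B ->
  (\int[mu]_(x in `]p, q[) (f x)%:E = (B - A)%:E)%E.
Proof.
move=> pq f0 cf dF FA FB.
have mf : measurable_fun `]p, q[ f.
  apply: open_continuous_measurable_fun; first exact: interval_open.
  by move=> x; rewrite inE /= in_itv /=; exact: cf.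
have := ge0_cvg_inner_itv pq mf f0.
under eq_fun => n.
  have [h1 h2 h3] := inner_itv_bounds n pq.
  rewrite (FTC2_closed_sub h1 h2 h3 cf dF); over.
move=> /cvg_lim <- //; apply/cvg_lim => //.
by apply: cvg_EFin; [exact: nearW|exact: cvgB].
Qed.

End exhaustion.

(** * Euler's beta integral *)

Section beta_integral.
Context {R : realType}.
Notation mu := (@lebesgue_measure R).
Implicit Types (a b c d t x r : R).

Definition beta_kernel a b t : R := t `^ (a - 1) * (1 - t) `^ (b - 1).

Lemma continuous_powR r x : 0 < x -> {for x, continuous (@powR R ^~ r)}.
Proof.
move=> x0; apply/differentiable_continuous/derivable1_diffP.
by apply: derivable_powR; rewrite in_itv /= x0.
Qed.

Lemma continuous_onem_powR r x : x < 1 ->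
  {for x, continuous (fun t : R => (1 - t) `^ r)}.
Proof.
move=> x1; apply: (@continuous_comp _ _ _ (fun t : R => 1 - t) (@powR R ^~ r)).
  by apply: continuousB; [exact: cvg_cst|exact: cvg_id].
by apply: continuous_powR; rewrite subr_gt0.
Qed.

Lemma is_derive_onem_powR r x : x < 1 ->
  is_derive x 1 (fun t : R => (1 - t) `^ r) (- (r * (1 - x) `^ (r - 1))).
Proof.
move=> x1; have x0 : 0 < 1 - x by rewrite subr_gt0.
have := @is_derive1_comp R (@powR R ^~ r) (fun t : R => 1 - t) x
  (r * (1 - x) `^ (r - 1)) (- 1) (is_derive1_powR r x0).
rewrite mulrN1; apply.
by apply: is_derive_eq; rewrite add0r mul1r.
Qed.

Lemma continuous_beta_kernel a b x : 0 < x < 1 ->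
  {for x, continuous (beta_kernel a b)}.
Proof.
move=> /andP[x0 x1]; apply: continuousM; first exact: continuous_powR.
exact: continuous_onem_powR.
Qed.

Lemma beta_kernel_ge0 a b t : 0 <= beta_kernel a b t.
Proof. by rewrite mulr_ge0 ?powR_ge0. Qed.

Lemma measurable_beta_kernel a b : measurable_fun (`]0, 1[%classic : set R)
  (beta_kernel a b).
Proof.
apply: open_continuous_measurable_fun; first exact: interval_open.
by move=> x; rewrite inE /= in_itv /=; exact: continuous_beta_kernel.
Qed.

Lemma is_derive_beta_kernel a b x : 0 < x < 1 ->
  is_derive x 1 (beta_kernel (a + 1) (b + 1))
    (a * beta_kernel a (b + 1) x - b * beta_kernel (a + 1) b x).
Proof.
move=> /andP[x0 x1]; rewrite /beta_kernel !addrK.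
have d1 := is_derive1_powR a x0; have d2 := is_derive_onem_powR b x1.
by apply: is_derive_eq; rewrite /GRing.scale /=; ring.
Qed.

(** One bound for both signs of $r$: the power is at most 1 if $r \ge 0$ and at most $m^r$ if $r <
    0$. *)
Lemma powR_le1D r m t : 0 < m -> m <= t <= 1 -> t `^ r <= 1 + m `^ r.
Proof.
move=> m0 /andP[mt t1]; have t0 : 0 < t by exact: lt_le_trans mt.
have [r0|r0] := leP 0 r.
  rewrite (@le_trans _ _ 1) ?lerDl ?powR_ge0//.
  have := @ge0_ler_powR R r r0 t 1; rewrite powR1.
  by apply=> //; rewrite nnegrE ltW.
rewrite (@le_trans _ _ (m `^ r)) ?lerDr//.
rewrite -(opprK r) 2!(powRN _ (- r)) lef_pV2 ?posrE ?powR_gt0//.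
by rewrite ge0_ler_powR ?oppr_ge0 ?nnegrE // ltW.
Qed.

Lemma cvg_powR_harmonic r : 0 < r -> (n.+3%:R^-1 : R) `^ r @[n --> \oo] --> 0.
Proof.
move=> r0; have := (@cvg_at_rightP R (@powR R ^~ r) 0 0).1 (powR_cvg0 r0).
apply; split; first by move=> n; rewrite invr_gt0.
by have := @cvg_harmonic R; rewrite -(cvg_shiftn 2);
  under eq_fun do rewrite addn2.
Qed.

Lemma cvg_onem_powR_harmonic r :
  (1 - n.+3%:R^-1 : R) `^ r @[n --> \oo] --> (1 : R).
Proof.
have h : (fun n => n.+3%:R^-1 : R) @ \oo --> 0.
  by have := @cvg_harmonic R; rewrite -(cvg_shiftn 2);
    under eq_fun do rewrite addn2.
have : (fun t : R => (1 - t) `^ r) @ (0 : R) --> (1 - 0) `^ r.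
  exact: continuous_onem_powR.
by rewrite subr0 powR1; exact: cvg_comp.
Qed.

Lemma integral_beta_kernel1r a : 0 < a ->
  (\int[mu]_(t in `]0%R, 1%R[) (t `^ (a - 1))%:E = (a^-1)%:E)%E.
Proof.
move=> a0; rewrite -[in RHS](subr0 a^-1).
apply: (@ge0_FTC2_oo R 0 1 _ (fun t => a^-1 * t `^ a)) => //.
- by move=> x _; exact: powR_ge0.
- by move=> x /andP[x0 _]; exact: continuous_powR.
- move=> x /andP[x0 _]; have d1 := is_derive1_powR a x0.
  apply: is_derive_eq; rewrite /GRing.scale /= mulrA mulVf ?mul1r// gt_eqF//.
- under eq_fun do rewrite add0r subr0 mul1r.
  by have := cvgMl_tmp (a := a^-1) (cvg_powR_harmonic a0) => h;
    rewrite mulr0 in h; exact: h.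
- under eq_fun do rewrite subr0 mul1r.
  by have := cvgMl_tmp (a := a^-1) (cvg_onem_powR_harmonic a) => h;
    rewrite mulr1 in h; exact: h.
Qed.

Lemma integral_beta_kernel1l b : 0 < b ->
  (\int[mu]_(t in `]0%R, 1%R[) ((1 - t) `^ (b - 1))%:E = (b^-1)%:E)%E.
Proof.
move=> b0; rewrite -[in RHS](opprK b^-1) -[in RHS](sub0r (- b^-1)).
apply: (@ge0_FTC2_oo R 0 1 _ (fun t => - b^-1 * (1 - t) `^ b)) => //.
- by move=> x _; exact: powR_ge0.
- by move=> x /andP[_ x1]; exact: continuous_onem_powR.
- move=> x /andP[_ x1]; have d1 := is_derive_onem_powR b x1.
  apply: is_derive_eq; rewrite /GRing.scale /= mulrNN mulrA mulVf ?mul1r//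
    gt_eqF//.
- under eq_fun do rewrite add0r subr0 mul1r.
  by have := cvgMl_tmp (a := (- b^-1)) (cvg_onem_powR_harmonic b) => h;
    rewrite mulr1 in h; exact: h.
- under eq_fun do rewrite subr0 mul1r opprB addrC subrK.
  by have := cvgMl_tmp (a := (- b^-1)) (cvg_powR_harmonic b0) => h;
    rewrite mulr0 in h; exact: h.
Qed.

(** On each half of the interval one factor is bounded, so a multiple of $t^{a-1} + (1-t)^{b-1}$
    dominates; the two summands have explicit integrals. *)
Lemma integrable_beta_kernel a b : 0 < a -> 0 < b ->
  mu.-integrable (`]0, 1[%classic : set R) (EFin \o beta_kernel a b).
Proof.
move=> a0 b0; pose K := 1 + 2^-1 `^ (b - 1) + (1 + 2^-1 `^ (a - 1)) : R.
have K0 : 0 <= K by rewrite !addr_ge0 ?powR_ge0.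
have i1 : mu.-integrable (`]0, 1[%classic : set R) (EFin \o (fun t : R => t `^
  (a - 1))).
  apply/integrableP; split.
    by apply/measurable_EFinP; apply: measurable_funTS; exact: measurable_powR.
  under eq_integral do rewrite /= ger0_norm ?powR_ge0//.
  by rewrite integral_beta_kernel1r ?ltry.
have i2 : mu.-integrable (`]0, 1[%classic : set R) (EFin \o (fun t : R => (1 -
  t) `^ (b - 1))).
  apply/integrableP; split.
    apply/measurable_EFinP.
    apply: open_continuous_measurable_fun; first exact: interval_open.
    move=> x; rewrite inE /= in_itv /= => /andP[_ x1].
    exact: continuous_onem_powR.
  under eq_integral do rewrite /= ger0_norm ?powR_ge0//.
  by rewrite integral_beta_kernel1l ?ltry.
apply: (@le_integrable _ _ _ mu _ (measurable_itv _) _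
  (EFin \o (fun t : R => K * (t `^ (a - 1) + (1 - t) `^ (b - 1))))).
- by apply/measurable_EFinP; exact: measurable_beta_kernel.
- move=> t; rewrite /= in_itv /= => /andP[t0 t1].
  rewrite lee_fin !ger0_norm ?mulr_ge0 ?addr_ge0 ?powR_ge0 ?beta_kernel_ge0//.
  have h0 : 0 < 2^-1 :> R by rewrite invr_gt0.
  rewrite mulrDr; have [th|th] := leP t 2^-1.
    rewrite (@le_trans _ _ (K * t `^ (a - 1))) ?lerDl ?mulr_ge0 ?powR_ge0//.
    rewrite /beta_kernel mulrC ler_wpM2r ?powR_ge0//.
    rewrite (@le_trans _ _ (1 + 2^-1 `^ (b - 1))) ?lerDl ?addr_ge0 ?powR_ge0//.
    by apply: powR_le1D => //; apply/andP; split; lra.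
  rewrite (@le_trans _ _ (K * (1 - t) `^ (b - 1))) ?lerDr ?mulr_ge0 ?powR_ge0//.
  rewrite /beta_kernel ler_wpM2r ?powR_ge0//.
  rewrite (@le_trans _ _ (1 + 2^-1 `^ (a - 1))) ?lerDr ?addr_ge0 ?powR_ge0//.
  by apply: powR_le1D => //; apply/andP; split; lra.
- have i3 : mu.-integrable (`]0, 1[%classic : set R)
    (EFin \o (fun t : R => t `^ (a - 1) + (1 - t) `^ (b - 1))).
    by apply: eq_integrable (integrableD _ i1 i2).
  by apply: eq_integrable (integrableZl _ K i3).
Qed.

(** [euler_beta] is the real part, by [fine], of an extended integral; finiteness lets one pass
    between the two. *)
Lemma integral_beta_kernel a b : 0 < a -> 0 < b ->
  (\int[mu]_(t in `]0%R, 1%R[) (beta_kernel a b t)%:E = (euler_beta a b)%:E)%E.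
Proof.
move=> a0 b0; rewrite /euler_beta /Rintegral fineK//.
exact: integrable_fin_num (integrable_beta_kernel a0 b0).
Qed.

(** On $[1/3, 2/3]$ the kernel is bounded below by a positive constant. *)
Lemma euler_beta_gt0 a b : 0 < a -> 0 < b -> 0 < euler_beta a b.
Proof.
move=> a0 b0; rewrite -lte_fin -integral_beta_kernel//.
(* The inverse of the upper bound of [powR_le1D] for the exponent $-r$, hence a lower bound for
   $t^r$. *)
pose k r : R := (1 + 3^-1 `^ (- r))^-1.
have k0 r : 0 < k r by rewrite invr_gt0 ltr_pwDl ?powR_ge0.
have kP r t : 3^-1 <= t <= 1 -> k r <= t `^ r.
  move=> h; have t0 : 0 < t by case/andP: h => h _; rewrite (lt_le_trans _ h).
  rewrite /k -[X in _ <= _ `^ X]opprK (powRN t) lef_pV2 ?posrE ?powR_gt0//.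
  exact: powR_le1D.
have pq : (3^-1 : R) <= 2 / 3 by lra.
apply: (@lt_le_trans _ _ (\int[mu]_(t in `[3^-1%R, (2 / 3)%R])
    (k (a - 1) * k (b - 1))%:E)%E).
  rewrite integral_cst//= lebesgue_measure_itv /= lte_fin.
  have -> : (3^-1 : R) < 2 / 3 by lra.
  by rewrite -EFinB -EFinM lte_fin !mulr_gt0//; lra.
have sub : (`[3^-1, 2 / 3]%classic : set R) `<=` `]0, 1[%classic.
  by move=> t; rewrite /= !in_itv /= => /andP[h1 h2]; apply/andP; split; lra.
apply: (@le_trans _ _ (\int[mu]_(t in `[3^-1%R, (2 / 3)%R])
    (beta_kernel a b t)%:E)%E).
  apply: ge0_le_integral => //.
  - by move=> t _; rewrite lee_fin mulr_ge0// ltW.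
  - apply/measurable_EFinP; apply: measurable_funS sub _ => //.
    exact: measurable_beta_kernel.
  - move=> t; rewrite /= in_itv /= => /andP[h1 h2].
    rewrite lee_fin ler_pM ?kP//; [exact: ltW|exact: ltW| |].
      by apply/andP; split; lra.
    by apply/andP; split; lra.
apply: ge0_subset_integral => //.
- by apply/measurable_EFinP; exact: measurable_beta_kernel.
- by move=> t _; rewrite lee_fin beta_kernel_ge0.
Qed.

End beta_integral.

(** * Recursion for the beta function *)

Section beta_recursion.
Context {R : realType}.
Notation mu := (@lebesgue_measure R).
Implicit Types (a b c d t x r : R).

Lemma cvg_inner_beta_kernel a b k : 0 < a -> 0 < b -> 0 <= k ->
  (\int[mu]_(x in inner_itv 0%R 1%R n) (k * beta_kernel a b x)%:E @[n --> \oo]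
   --> (k * euler_beta a b)%:E)%E.
Proof.
move=> a0 b0 k0; have -> : ((k * euler_beta a b)%:E =
    \int[mu]_(x in `]0%R, 1%R[) (k * beta_kernel a b x)%:E)%E.
  under eq_integral do rewrite EFinM.
  by rewrite integralZl ?integral_beta_kernel//; exact: integrable_beta_kernel.
apply: ge0_cvg_inner_itv => //.
- by apply: measurable_funM => //; exact: measurable_beta_kernel.
- by move=> x _; rewrite mulr_ge0 ?beta_kernel_ge0.
Qed.

Lemma cvg_beta_kernel_endpoints a b : 0 < a -> 0 < b ->
  beta_kernel (a + 1) (b + 1) n.+3%:R^-1 @[n --> \oo] --> (0 : R).
Proof.
move=> a0 b0; rewrite /beta_kernel !addrK.
have h := cvgM (cvg_powR_harmonic a0) (cvg_onem_powR_harmonic b).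
by rewrite mul0r in h; exact: h.
Qed.

Lemma beta_kernelC a b x : beta_kernel a b (1 - x) = beta_kernel b a x.
Proof. by rewrite /beta_kernel opprB addrCA subrr addr0 mulrC. Qed.

(** Integrate the derivative of $t^a(1-t)^b$, whose boundary values tend to 0. That derivative
    changes sign, so the two nonnegative terms pass to the limit separately. *)
Lemma euler_beta_by_parts a b : 0 < a -> 0 < b ->
  a * euler_beta a (b + 1) = b * euler_beta (a + 1) b.
Proof.
move=> a0 b0; have a10 : 0 < a + 1 by rewrite addr_gt0.
have b10 : 0 < b + 1 by rewrite addr_gt0.
have cu := cvg_inner_beta_kernel a0 b10 (ltW a0).
have cv := cvg_inner_beta_kernel a10 b0 (ltW b0).
have uvE n : (\int[mu]_(x in inner_itv 0%R 1%R n) (a * beta_kernel a (b + 1)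
  x)%:E -
   \int[mu]_(x in inner_itv 0%R 1%R n) (b * beta_kernel (a + 1) b x)%:E =
   (beta_kernel (b + 1) (a + 1) n.+3%:R^-1
      - beta_kernel (a + 1) (b + 1) n.+3%:R^-1)%:E)%E.
  have [h1 h2 h3] := inner_itv_bounds n (@ltr01 R).
  have iS f : mu.-integrable (`]0, 1[%classic : set R) f ->
      mu.-integrable (inner_itv 0 1 n) f.
    by apply: integrableS; [exact: measurable_itv|exact: measurable_itv|exact:
      inner_itv_sub].
  rewrite -integralB_EFin//; last 3 first.
  - exact: measurable_itv.
  - apply: iS.
    by apply: eq_integrable (integrableZl _ a (integrable_beta_kernel a0 b10)).
  - apply: iS.
    by apply: eq_integrable (integrableZl _ b (integrable_beta_kernel a10 b0)).
  under eq_integral do rewrite -EFinB.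
  have ck x : 0 < x < 1 -> {for x, continuous
      (fun t => a * beta_kernel a (b + 1) t - b * beta_kernel (a + 1) b t)}.
    by move=> x01; apply: continuousB; apply: continuousM;
      [exact: cvg_cst|exact: continuous_beta_kernel..
      |exact: cvg_cst|exact: continuous_beta_kernel].
  rewrite /inner_itv (FTC2_closed_sub h1 h2 h3 ck (@is_derive_beta_kernel R a
    b)).
  by rewrite subr0 !mul1r add0r beta_kernelC.
have h : ((beta_kernel (b + 1) (a + 1) n.+3%:R^-1
      - beta_kernel (a + 1) (b + 1) n.+3%:R^-1)%:E @[n --> \oo] -->
    (a * euler_beta a (b + 1))%:E - (b * euler_beta (a + 1) b)%:E)%E.
  by under eq_cvg do rewrite -uvE; apply: (cvgeB _ cu cv).
apply/eqP; rewrite -subr_eq0; apply/eqP.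
have : (0%:E = (a * euler_beta a (b + 1) - b * euler_beta (a + 1) b)%:E)%E.
  rewrite EFinB -(cvg_lim (@ereal_hausdorff R) h).
  apply/esym/cvg_lim; first exact: ereal_hausdorff.
  apply: cvg_EFin; first exact: nearW.
  rewrite -[X in _ --> X](subr0 0).
  by apply: cvgB; exact: cvg_beta_kernel_endpoints.
by case.
Qed.

(** Integrated form of $t + (1-t) = 1$. *)
Lemma euler_beta_split a b : 0 < a -> 0 < b ->
  euler_beta (a + 1) b + euler_beta a (b + 1) = euler_beta a b.
Proof.
move=> a0 b0; have a10 : 0 < a + 1 by rewrite addr_gt0.
have b10 : 0 < b + 1 by rewrite addr_gt0.
apply: EFin_inj; rewrite EFinD -!integral_beta_kernel//.
rewrite -integralD_EFin//; [|exact: integrable_beta_kernel..].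
apply: eq_integral => t; rewrite inE /= in_itv /= => /andP[t0 t1].
rewrite -EFinD /beta_kernel !addrK; congr (_%:E).
rewrite -(mulr_powRB1 (ltW t0) a0) -[(1 - t) `^ b](mulr_powRB1 _ b0);
  last first.
  by rewrite subr_ge0 ltW.
by ring.
Qed.

Lemma euler_betaS a b : 0 < a -> 0 < b ->
  euler_beta a (b + 1) = b / (a + b) * euler_beta a b.
Proof.
move=> a0 b0; have ab0 : a + b != 0 by rewrite gt_eqF// addr_gt0.
rewrite -(euler_beta_split a0 b0); apply: (mulfI ab0).
rewrite mulrA [(a + b) * (_ / _)]mulrC divfK// mulrDr mulrDl.
by rewrite euler_beta_by_parts.
Qed.

Lemma euler_beta_rising a b n : 0 < a -> 0 < b ->
  euler_beta a (b + n%:R) = beta_moment a b n * euler_beta a b.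
Proof.
move=> a0 b0; elim: n => [|n IH].
  by rewrite addr0 /beta_moment !rising0 divr1 mul1r.
have bn0 : 0 < b + n%:R by rewrite ltr_wpDr.
rewrite -natr1 addrA euler_betaS// IH /beta_moment !risingSr addrA.
have r0 : rising (a + b) n != 0 by rewrite gt_eqF// rising_gt0// addr_gt0.
have s0 : a + b + n%:R != 0 by rewrite gt_eqF// ltr_wpDr// addr_gt0.
by field; rewrite r0 s0.
Qed.

End beta_recursion.

(** * The beta density and its moments *)

Section beta_density.
Context {R : realType}.
Notation mu := (@lebesgue_measure R).
Notation I := (`]-1, 1[%classic : set R).
Implicit Types (a b c d t x r : R).

Let N11 : -1 < 1 :> R. Proof. by rewrite gtrN. Qed.

Lemma beta_densityE a b x : -1 < x < 1 -> beta_density a b x =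
  (x + 1) `^ (a - 1) * (1 - x) `^ (b - 1) / (euler_beta a b * 2 `^ (a + b - 1)).
Proof.
move=> /andP[x1 x2]; rewrite /beta_density ifT//.
by rewrite ler_norml !ltW.
Qed.

Lemma beta_density_gt0 a b x : 0 < a -> 0 < b -> -1 < x < 1 ->
  0 < beta_density a b x.
Proof.
move=> a0 b0 x1; rewrite beta_densityE//; case/andP: x1 => x1 x2.
rewrite divr_gt0 ?mulr_gt0 ?powR_gt0 ?euler_beta_gt0//;
  first by rewrite -ltrBlDr sub0r.
by rewrite subr_gt0.
Qed.

Lemma beta_density_ge0 a b x : 0 < a -> 0 < b -> 0 <= beta_density a b x.
Proof.
move=> a0 b0; rewrite /beta_density; case: ifP => // _.
by rewrite divr_ge0 ?mulr_ge0 ?powR_ge0 ?ltW// euler_beta_gt0.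
Qed.

Lemma continuous_beta_density a b x : -1 < x < 1 ->
  {for x, continuous (beta_density a b)}.
Proof.
move=> x1.
pose f x := (x + 1) `^ (a - 1) * (1 - x) `^ (b - 1)
  / (euler_beta a b * 2 `^ (a + b - 1)).
have cf : {for x, continuous f}.
  case/andP: x1 => x1 x2.
  apply: continuousM; last exact: cvg_cst.
  apply: continuousM; last exact: continuous_onem_powR.
  apply: (@continuous_comp _ _ _ (fun t : R => t + 1) (@powR R ^~ (a - 1))).
    by apply: continuousD; [exact: cvg_id|exact: cvg_cst].
  by apply: continuous_powR; rewrite -ltrBlDr sub0r.
rewrite /prop_for /continuous_at (beta_densityE _ _ x1); apply: cvg_trans cf.
(* Near an interior point the case distinction in the density is settled. *)
apply: near_eq_cvg; have := @near_in_itvoo R (-1) 1 x;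
  rewrite in_itv /= => /(_ x1).
by apply: filterS => y; rewrite in_itv /= => y1; rewrite beta_densityE.
Qed.

Lemma measurable_beta_density a b : measurable_fun I (beta_density a b).
Proof.
apply: open_continuous_measurable_fun; first exact: interval_open.
by move=> x; rewrite inE /= in_itv /=; exact: continuous_beta_density.
Qed.

(** The substitution $t = (x+1)/2$ maps the inner intervals of $]-1,1[$ onto those of $]0,1[$, so it
    is carried out on compact intervals and the limits are compared. *)
Lemma integral_beta_density a b : 0 < a -> 0 < b ->
  (\int[mu]_(x in I) (beta_density a b x)%:E = 1%:E)%E.
Proof.
move=> a0 b0; pose B := euler_beta a b.
have B0 : B != 0 by rewrite gt_eqF// euler_beta_gt0.
have h0 x : -1 < x < 1 -> 0 <= beta_density a b x.
  by move=> x1; exact/ltW/beta_density_gt0.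
have c1 := ge0_cvg_inner_itv N11 (measurable_beta_density a b) h0.
have c2 : (\int[mu]_(x in inner_itv 0%R 1%R n) (B^-1 * beta_kernel a b x)%:E
    @[n --> \oo] --> 1%:E)%E.
  have Bi0 : 0 <= B^-1 by rewrite invr_ge0 ltW// euler_beta_gt0.
  by have := cvg_inner_beta_kernel a0 b0 Bi0; rewrite mulVf.
rewrite -(cvg_lim (@ereal_hausdorff R) c1) -(cvg_lim (@ereal_hausdorff R) c2).
congr (limn _); apply/funext => n.
pose F (x : R) : R := (x + 1) / 2.
have dF x : is_derive x 1 F 2^-1.
  by apply: is_derive_eq; rewrite /GRing.scale /=; ring.
have F'E : derive1 F = cst 2^-1.
  by apply/funext => x; rewrite derive1E; apply: derive_val.
have [h1 h2 h3] := inner_itv_bounds n N11.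
have [g1 g2 g3] := inner_itv_bounds n (@ltr01 R).
have FaE : F (-1 + (1 - -1) * n.+3%:R^-1) = 0 + (1 - 0) * n.+3%:R^-1.
  by rewrite /F; field.
have FbE : F (1 - (1 - -1) * n.+3%:R^-1) = 1 - (1 - 0) * n.+3%:R^-1.
  by rewrite /F; field.
have cF x : {for x, continuous F}.
  exact/differentiable_continuous/derivable1_diffP.
have cK (x : R) : 0 < x < 1 ->
    {for x, continuous (fun y : R => B^-1 * beta_kernel a b y)}.
  move=> x01; apply: continuousM; first exact: cvg_cst.
  exact: continuous_beta_kernel.
rewrite /inner_itv -FaE -FbE integration_by_substitution_increasing.
- apply: eq_integral => x; rewrite inE => /(inner_itv_sub N11).
  rewrite /= in_itv /= => x1; congr (_%:E).
  rewrite beta_densityE// F'E !fctE /beta_kernel /F -/B.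
  have -> : 1 - (x + 1) / 2 = (1 - x) / 2 by field.
  case/andP: x1 => x1 x2.
  rewrite !powRM ?invr_ge0 ?subr_ge0 ?(ltW x2)//; last first.
    by rewrite -lerBlDr sub0r ltW.
  (* One factor 2 is the Jacobian; the other two rescale $x+1$ and $1-x$. *)
  have -> : 2 `^ (a + b - 1) = 2 * 2 `^ (a - 1) * 2 `^ (b - 1).
    rewrite -[X in X * _ * _]powRr1// -!powRD ?pnatr_eq0 ?implybT//.
    by congr (_ `^ _); ring.
  have pV r : 2^-1 `^ r = (2 `^ r)^-1 :> R.
    by rewrite -powR_inv1// -powRrM mulN1r powRN.
  have p0 r : 2 `^ r != 0 :> R by rewrite gt_eqF// powR_gt0.
  by rewrite !pV /=; field; rewrite B0 !p0.
- exact: ltW.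
- by move=> x y _ _ xy; rewrite /F ltr_pM2r ?invr_gt0// ltrD2r.
- by rewrite F'E => x _; exact: cvg_cst.
- by rewrite F'E; exact: is_cvg_cst.
- by rewrite F'E; exact: is_cvg_cst.
- split; first by move=> x _.
  + by apply: cvg_at_right_filter; exact: cF.
  + by apply: cvg_at_left_filter; exact: cF.
- apply: continuous_in_subspaceT => x;
  rewrite FaE FbE inE => /(inner_itv_sub (@ltr01 R)).
  by rewrite /= in_itv /=; exact: cK.
Qed.

Lemma integrable_beta_density a b : 0 < a -> 0 < b ->
  mu.-integrable I (EFin \o beta_density a b).
Proof.
move=> a0 b0; apply/integrableP; split.
  by apply/measurable_EFinP; exact: measurable_beta_density.
rewrite [ltLHS](_ : _ = 1%:E) ?ltry// -(integral_beta_density a0 b0).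
apply: eq_integral => x; rewrite inE /= in_itv /= => x1.
by rewrite ger0_norm// ltW// beta_density_gt0.
Qed.

(** Multiplication by $t^n$ only raises $b$ by $n$, and the moment is the ratio of the normalizing
    constants. A polynomial times the density is then a combination of densities of total mass 1. *)
Lemma beta_density_monomial a b n x : 0 < a -> 0 < b -> -1 < x < 1 ->
  ((1 - x) / 2) ^+ n * beta_density a b x =
  beta_moment a b n * beta_density a (b + n%:R) x.
Proof.
move=> a0 b0 x1; rewrite !beta_densityE// euler_beta_rising//.
case/andP: x1 => x1 x2; have y0 : 0 < 1 - x by rewrite subr_gt0.
have -> : b + n%:R - 1 = n%:R + (b - 1) by ring.
have -> : a + (b + n%:R) - 1 = n%:R + (a + b - 1) by ring.
have pD (y r : R) : 0 < y -> y `^ (n%:R + r) = y ^+ n * y `^ r.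
  by move=> yp; rewrite powRD ?(gt_eqF yp) ?implybT// powR_mulrn// ltW.
rewrite !pD// expr_div_n.
have B0 : euler_beta a b != 0 by rewrite gt_eqF// euler_beta_gt0.
have p0 r : 2 `^ r != 0 :> R by rewrite gt_eqF// powR_gt0.
have m0 : beta_moment a b n != 0.
  by rewrite gt_eqF// divr_gt0 ?rising_gt0 ?addr_gt0.
have q0 : 2 ^+ n != 0 :> R by rewrite expf_neq0// pnatr_eq0.
by field; rewrite B0 p0 m0 q0.
Qed.

Lemma poly_beta_densityE (p : {poly R}) a b x : 0 < a -> 0 < b -> -1 < x < 1 ->
  p.[(1 - x) / 2] * beta_density a b x =
  \sum_(i < size p) p`_i * beta_moment a b i * beta_density a (b + i%:R) x.
Proof.
move=> a0 b0 x1; rewrite horner_coef mulr_suml; apply: eq_bigr => i _.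
by rewrite -mulrA beta_density_monomial// mulrA.
Qed.

Let integrable_term (p : {poly R}) a b (i : nat) : 0 < a -> 0 < b ->
  mu.-integrable I (fun x =>
   (p`_i * beta_moment a b i * beta_density a (b + i%:R) x)%:E).
Proof.
move=> a0 b0; have bi0 : 0 < b + i%:R by rewrite ltr_wpDr.
apply: eq_integrable (integrableZl _ (p`_i * beta_moment a b i)
  (integrable_beta_density a0 bi0)) => //.
Qed.

Lemma integrable_poly_beta_density (p : {poly R}) a b : 0 < a -> 0 < b ->
  mu.-integrable I (fun x => (p.[(1 - x) / 2] * beta_density a b x)%:E).
Proof.
move=> a0 b0.
have h : mu.-integrable I (fun x => \sum_(i < size p)
    (p`_i * beta_moment a b i * beta_density a (b + i%:R) x)%:E)%E.
  by apply: integrable_sum => // i _; exact: integrable_term.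
apply: eq_integrable h => // x; rewrite inE /= in_itv /= => x1.
by rewrite poly_beta_densityE// sumEFin.
Qed.

Lemma integral_poly_beta_density (p : {poly R}) a b : 0 < a -> 0 < b ->
  (\int[mu]_(x in I) (p.[(1 - x) / 2] * beta_density a b x)%:E
   = (moment_fun a b p)%:E)%E.
Proof.
move=> a0 b0.
transitivity (\int[mu]_(x in I) \sum_(i < size p)
    (p`_i * beta_moment a b i * beta_density a (b + i%:R) x)%:E)%E.
  apply: eq_integral => x; rewrite inE /= in_itv /= => x1.
  by rewrite poly_beta_densityE// sumEFin.
rewrite integral_sum//; last by move=> i; exact: integrable_term.
rewrite -sumEFin; apply: eq_bigr => i _.
have bi0 : 0 < b + i%:R by rewrite ltr_wpDr.
under eq_integral do rewrite EFinM.
rewrite integralZl//; last exact: integrable_beta_density.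
by rewrite integral_beta_density// mule1.
Qed.

End beta_density.

(** * Bernstein polynomials *)

Section bernstein.
Context {R : realType}.
Implicit Types (phi psi : nat -> R) (s y : R).

(* The recursion is that of a binomial sum of independent trials:
   [bernstein n phi] is [\sum_k 'C(n, k) phi k X^k (1 - X)^(n - k)]. *)
Fixpoint bernstein n phi : {poly R} :=
  if n is m.+1 then
    'X * bernstein m (phi \o succn) + (1 - 'X) * bernstein m phi
  else (phi 0)%:P.

Lemma horner_bernsteinS n phi s : (bernstein n.+1 phi).[s] =
  s * (bernstein n (phi \o succn)).[s] + (1 - s) * (bernstein n phi).[s].
Proof. by rewrite /= !hornerE. Qed.

Lemma le_bernstein n phi psi s : 0 <= s <= 1 -> (forall k, phi k <= psi k) ->
  (bernstein n phi).[s] <= (bernstein n psi).[s].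
Proof.
move=> /andP[s0 s1]; elim: n phi psi => [|n IH] phi psi h.
  by rewrite /= !hornerC.
rewrite !horner_bernsteinS lerD// ler_wpM2l ?subr_ge0//; apply: IH => k //.
exact: h.
Qed.

Lemma bernstein_affine n phi u v s :
  (bernstein n (fun k => u + v * phi k)).[s] = u + v * (bernstein n phi).[s].
Proof.
elim: n phi => [|n IH] phi; first by rewrite /= !hornerC.
by rewrite !horner_bernsteinS IH (IH (phi \o succn)); ring.
Qed.

(** Variance plus squared bias of a binomial variable. The centre $y$ is arbitrary because the
    recursion shifts it by one. *)
Lemma bernstein_variance n y s :
  (bernstein n (fun k => (k%:R - y) ^+ 2)).[s] =
  n%:R * (s * (1 - s)) + (n%:R * s - y) ^+ 2.
Proof.
elim: n y => [|n IH] y; first by rewrite /= hornerC; ring.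
rewrite horner_bernsteinS IH.
have -> : (fun k => (k%:R - y) ^+ 2) \o succn =
    (fun k => (k%:R - (y - 1)) ^+ 2).
  by apply/funext => k /=; rewrite -natr1; congr (_ ^+ 2); ring.
by rewrite IH -natr1; ring.
Qed.

Lemma bernstein_bounds n phi s m M : 0 <= s <= 1 ->
  (forall k, m <= phi k <= M) -> m <= (bernstein n phi).[s] <= M.
Proof.
move=> s01 h.
have cstE u : (bernstein n (fun=> u)).[s] = u.
  elim: n => [|n IH]; first by rewrite /= hornerC.
  rewrite horner_bernsteinS (_ : (fun=> u) \o succn = (fun=> u))//.
  by rewrite IH; ring.
rewrite -[m]cstE -[M]cstE; apply/andP.
by split; apply: le_bernstein => // k; case/andP: (h k).
Qed.

(** Chebyshev's argument: $|g(s)-g(y)| \le e/2 + C(y-s)^2$ for all $y$, and the positive Bernstein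
    operator turns the quadratic term into a variance of order $1/N$. Continuity at the single point
    $s$ suits functions controlled only inside the interval. *)
Lemma cvg_bernstein (g : R -> R) M s : 0 <= s <= 1 ->
  (forall y, 0 <= g y <= M) -> {for s, continuous g} ->
  (bernstein n.+1 (fun k => g (k%:R / n.+1%:R))).[s] @[n --> \oo] --> g s.
Proof.
move=> s01 gM cg; apply/cvgrPdist_le => e e0.
have e20 : 0 < e / 2 by rewrite divr_gt0.
have [d /= d0 dP] := (cvgrPdist_le _ _).1 cg _ e20.
have M0 : 0 <= M by case/andP: (gM s) => h1 h2; exact: le_trans h2.
(* At distance at least $d$ from $s$, the quadratic term exceeds $M$, which bounds the oscillation
   of $g$. *)
pose C := M / d ^+ 2.
have d20 : 0 < d ^+ 2 by rewrite exprn_gt0.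
have C0 : 0 <= C by rewrite divr_ge0// ltW.
have gP y : `|g s - g y| <= e / 2 + C * (y - s) ^+ 2.
  have [yd|yd] := ltP `|s - y| d.
    by rewrite (le_trans (dP y yd))// lerDl mulr_ge0// sqr_ge0.
  have : d ^+ 2 <= (y - s) ^+ 2.
    by rewrite -[leRHS]real_normK ?num_real// distrC lerXn2r ?nnegrE// ltW.
  move=> dy; have : M <= C * (y - s) ^+ 2.
    by rewrite /C mulrAC ler_pdivlMr// ler_wpM2l.
  case/andP: (gM y) => g1 g2; case/andP: (gM s) => g3 g4 h.
  by rewrite ler_norml; apply/andP; split; lra.
(* Threshold for $1/N$; adding 1 keeps the denominator positive when $C = 0$. *)
have r0 : 0 < e / 2 / (C + 1) by rewrite divr_gt0// ltr_wpDl.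
have := near_infty_natSinv_lt (PosNum r0); apply: filterS => n nP;
  rewrite /= in nP.
set N := n.+1%:R in nP *.
have N0 : 0 < N by rewrite ltr0n.
pose phi k := (k%:R - N * s) ^+ 2.
have phiE k : (k%:R / N - s) ^+ 2 = N ^- 2 * phi k.
  by rewrite /phi; field; rewrite gt_eqF.
pose b := (bernstein n.+1 (fun k => g (k%:R / N))).[s].
rewrite -[X in _ - X]/b.
have var : (bernstein n.+1 phi).[s] = N * (s * (1 - s)).
  by rewrite bernstein_variance subrr expr0n addr0.
have small : C * N ^- 2 * (bernstein n.+1 phi).[s] <= e / 2.
  rewrite var; have -> : C * N ^- 2 * (N * (s * (1 - s))) = C * (s * (1 - s)) *
    N^-1.
    by field; rewrite gt_eqF.
  have h : (C + 1) * N^-1 <= e / 2.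
    by rewrite mulrC -ler_pdivlMr ?ltr_wpDl// ltW.
  apply: le_trans h; rewrite ler_wpM2r ?invr_ge0 ?ltW//.
  case/andP: s01 => s0 s1.
  have : s * (1 - s) <= 1 by nra.
  have : 0 <= s * (1 - s) by rewrite mulr_ge0// subr_ge0.
  by move: C0; clear; nra.
have ub : b <= g s + e / 2 + C * N ^- 2 * (bernstein n.+1 phi).[s].
  rewrite -bernstein_affine; apply: le_bernstein => // k.
  have := gP (k%:R / N); rewrite phiE ler_norml mulrA /= => /andP[h1 h2].
  by set z := C * _ * _ in h1 h2 *; lra.
have lb : g s - e / 2 + - (C * N ^- 2) * (bernstein n.+1 phi).[s] <= b.
  rewrite -bernstein_affine; apply: le_bernstein => // k.
  have := gP (k%:R / N); rewrite phiE ler_norml mulrA /= => /andP[h1 h2].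
  by rewrite mulNr; set z := C * _ * _ in h1 h2 *; lra.
rewrite mulNr in lb; move: small ub lb; set z := C * _ * _ => small ub lb.
by rewrite ler_norml; apply/andP; split; lra.
Qed.

End bernstein.

(** * Mean square expansions *)

Section mean_square_approximation.
Context {R : realType}.
Notation mu := (@lebesgue_measure R).
Notation I := (`]-1, 1[%classic : set R).
Implicit Types (a b c d x : R) (p : {poly R}).

Let half_onem (x : R) := (1 - x) / 2.

Lemma dominated_cvg0_EFin (u : nat -> R -> R) (g : R -> R) :
  (forall n, measurable_fun I (u n)) ->
  (forall x, -1 < x < 1 -> u n x @[n --> \oo] --> 0) ->
  mu.-integrable I (EFin \o g) ->
  (forall n x, -1 < x < 1 -> `|u n x| <= g x) ->
  (\int[mu]_(x in I) (u n x)%:E @[n --> \oo] --> 0)%E.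
Proof.
move=> mu_ u0 ig ug.
suff : (\int[mu]_(x in I) (u n x)%:E @[n --> \oo] -->
    \int[mu]_(x in I) (cst 0 x))%E by rewrite integral0.
apply: (@dominated_cvg _ _ _ mu I _ (fun n x => (u n x)%:E) _ (EFin \o g)) =>
  //.
- by move=> n; apply/measurable_EFinP; exact: mu_.
- move=> x; rewrite /= in_itv /= => x1; apply: cvg_EFin; first exact: nearW.
  exact: u0.
Qed.

Lemma continuous_half_onem x : {for x, continuous half_onem}.
Proof.
apply: continuousM; last exact: cvg_cst.
by apply: continuousB; [exact: cvg_cst|exact: cvg_id].
Qed.

Lemma continuous_poly_half_onem p x :
  {for x, continuous (fun y : R => p.[half_onem y])}.
Proof.
apply: (@continuous_comp _ _ _ half_onem (horner p)).
  exact: continuous_half_onem.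
exact: continuous_horner.
Qed.

Lemma measurable_oo_continuous (f : R -> R) :
  (forall x, -1 < x < 1 -> {for x, continuous f}) -> measurable_fun I f.
Proof.
move=> cf; apply: open_continuous_measurable_fun; first exact: interval_open.
by move=> x; rewrite inE /= in_itv /=; exact: cf.
Qed.

Lemma cvge0_lt (u : nat -> \bar R) (e : R) : 0 < e ->
  (u n @[n --> \oo] --> 0)%E -> \forall n \near \oo, (u n < e%:E)%E.
Proof.
move=> e0 u0; apply: (u0 [set y | (y < e%:E)%E]).
rewrite /nbhs /= /ereal_nbhs /=.
by near=> r; rewrite lte_fin; near: r; exact: lt_nbhsl.
Unshelve. all: by end_near. Qed.

(** * Density of the polynomials in mean square *)

Section approximation.
Context (a b : R) (a0 : 0 < a) (b0 : 0 < b) (f : R -> R).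
Let w := beta_density a b.
Hypotheses (f0 : forall x, 0 <= f x)
  (cf : forall x, -1 < x < 1 -> {for x, continuous f}).

Let wx0 x : -1 < x < 1 -> 0 <= w x.
Proof. by move=> x1; exact/ltW/beta_density_gt0. Qed.

Let mw : measurable_fun I w.
Proof. exact: measurable_beta_density. Qed.

Let mf : measurable_fun I f.
Proof. exact: measurable_oo_continuous. Qed.

(** At each point the error vanishes once $k \ge f(x)$, and $f^2 w$ dominates. *)
Lemma cvg_truncation : mu.-integrable I (fun x => (f x ^+ 2 * w x)%:E) ->
  (\int[mu]_(x in I) ((f x - Num.min (f x) k%:R) ^+ 2 * w x)%:E
    @[k --> \oo] --> 0)%E.
Proof.
move=> if2; apply: dominated_cvg0_EFin if2 _ => [k|x x1|k x x1].
- apply: measurable_funM => //; apply: measurable_funX.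
  by apply: measurable_funB => //; exact: measurable_minr.
- apply: cvg_near_cst; near=> k.
  rewrite min_l ?subrr ?expr0n ?mul0r//.
  rewrite (le_trans (ltW (truncnS_gt _)))// ler_nat.
  by near: k; exact: nbhs_infty_ge.
- rewrite ger0_norm; last by apply: mulr_ge0; [exact: sqr_ge0|exact: wx0].
  rewrite ler_wpM2r ?wx0//.
  have k0 : 0 <= k%:R :> R by [].
  have m0 : 0 <= Num.min (f x) k%:R by rewrite le_min f0.
  have mf1 : Num.min (f x) k%:R <= f x by rewrite ge_min lexx.
  by rewrite lerXn2r ?nnegrE ?subr_ge0// gerBl.
Unshelve. all: by end_near. Qed.

(** The Bernstein polynomials are taken in $t = (1-x)/2$, hence the sample points $x = 1-2t$. They
    keep the bounds $0$ and $k$, so $k^2 w$ dominates. *)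
Lemma cvg_truncation_bernstein (k : nat) :
  (\int[mu]_(x in I) ((Num.min (f x) k%:R - (bernstein n.+1 (fun i =>
     Num.min (f (1 - 2 * (i%:R / n.+1%:R))) k%:R)).[half_onem x]) ^+ 2 * w x)%:E
    @[n --> \oo] --> 0)%E.
Proof.
pose g y := Num.min (f (1 - 2 * y)) k%:R.
have gk y : 0 <= g y <= k%:R.
  by rewrite /g le_min f0 ler0n/= ge_min lexx orbT.
have fE x : Num.min (f x) k%:R = g (half_onem x).
  by rewrite /g /half_onem; congr (Num.min (f _) _); field.
have h01 x : -1 < x < 1 -> 0 <= half_onem x <= 1.
  by rewrite /half_onem => /andP[x1 x2]; apply/andP; split; lra.
have cg x : -1 < x < 1 -> {for half_onem x, continuous g}.
  move=> x1; apply: continuous_min; last exact: cvg_cst.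
  apply: (@continuous_comp _ _ _ (fun y : R => 1 - 2 * y) f).
    apply: continuousB; first exact: cvg_cst.
    by apply: continuousM; [exact: cvg_cst|exact: cvg_id].
  by rewrite /half_onem mulrC divfK ?pnatr_eq0// subKr; exact: cf.
have mm : measurable_fun I (fun x => Num.min (f x) k%:R).
  by apply: measurable_minr => //; exact: measurable_cst.
have iw : mu.-integrable I (EFin \o (fun x => k%:R ^+ 2 * w x)).
  by apply: eq_integrable (integrableZl _ (k%:R ^+ 2)
    (integrable_beta_density a0 b0)).
apply: dominated_cvg0_EFin iw _ => [n|x x1|n x x1].
- apply: measurable_funM => //; apply: measurable_funX;
  apply: measurable_funB => //.
  by apply: measurable_oo_continuous => x _; exact: continuous_poly_half_onem.
(* The limit 0 is rewritten as $(g-g)^2 w$ to match the limit rules for products and differences. *)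
- rewrite fE -[X in _ --> X](mul0r (w x)) -[X in X * _](expr0n R 2).
  rewrite -[X in X ^+ 2](subrr (g (half_onem x))).
  apply: cvgM; last exact: cvg_cst.
  apply: cvgM; apply: cvgB; try exact: cvg_cst.
    exact: cvg_bernstein (h01 _ x1) gk (cg _ x1).
  exact: cvg_bernstein (h01 _ x1) gk (cg _ x1).
- rewrite ger0_norm; last by apply: mulr_ge0; [exact: sqr_ge0|exact: wx0].
  rewrite ler_wpM2r ?wx0//.
  rewrite fE; case/andP: (gk (half_onem x)) => g1 g2.
  have /andP[b1 b2] := bernstein_bounds n.+1 (h01 _ x1)
    (fun i => gk (i%:R / n.+1%:R)).
  rewrite -[leLHS]real_normK ?num_real// lerXn2r ?nnegrE//.
  by rewrite ler_norml; apply/andP; split; lra.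
Qed.

Lemma poly_dense_beta_density (e : R) : 0 < e ->
  mu.-integrable I (fun x => (f x ^+ 2 * w x)%:E) ->
  exists p, (\int[mu]_(x in I) ((f x - p.[half_onem x]) ^+ 2 * w x)%:E <
    e%:E)%E.
Proof.
(* A quarter for each error, because $(u+v)^2 \le 2(u^2+v^2)$ costs a factor 2. *)
move=> e0 if2; have e40 : 0 < e / 4 by rewrite divr_gt0.
have [k _ /(_ k (leqnn k)) /= kP] := cvge0_lt e40 (cvg_truncation if2).
have [n _ /(_ n (leqnn n)) /= nP] := cvge0_lt e40 (cvg_truncation_bernstein k).
pose p := bernstein n.+1 (fun i => Num.min (f (1 - 2 * (i%:R / n.+1%:R))) k%:R).
exists p; pose u x := (f x - Num.min (f x) k%:R) ^+ 2 * w x.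
pose v x := (Num.min (f x) k%:R - p.[half_onem x]) ^+ 2 * w x.
have mp : measurable_fun I (fun x => p.[half_onem x]).
  by apply: measurable_oo_continuous => x _; exact: continuous_poly_half_onem.
have mm : measurable_fun I (fun x => Num.min (f x) k%:R).
  by apply: measurable_minr => //; exact: measurable_cst.
have mu_ : measurable_fun I u.
  by apply: measurable_funM => //; apply: measurable_funX;
    exact: measurable_funB.
have mv : measurable_fun I v.
  by apply: measurable_funM => //; apply: measurable_funX;
    exact: measurable_funB.
have u0 x : I x -> 0 <= u x.
  by rewrite /= in_itv /= => x1; rewrite mulr_ge0 ?wx0//; exact: sqr_ge0.
have v0 x : I x -> 0 <= v x.
  by rewrite /= in_itv /= => x1; rewrite mulr_ge0 ?wx0//; exact: sqr_ge0.
apply: (@le_lt_trans _ _ (\int[mu]_(x in I) (2%:E * ((u x)%:E + (v x)%:E)))%E).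
  apply: ge0_le_integral => //.
  - move=> x; rewrite /= in_itv /= => x1.
    by rewrite lee_fin mulr_ge0 ?wx0//; exact: sqr_ge0.
  - apply/measurable_EFinP; apply: measurable_funM => //;
    apply: measurable_funX.
    exact: measurable_funB.
  - by apply: measurable_funeM; apply: emeasurable_funD; apply/measurable_EFinP.
  - move=> x; rewrite /= in_itv /= => x1; rewrite -EFinD -EFinM lee_fin.
    rewrite /u /v -mulrDl mulrA ler_wpM2r ?wx0//.
    set y := Num.min _ _; set z := p.[_].
    have := sqr_ge0 (f x - y - (y - z)); nra.
rewrite ge0_integralZl//; first last.
- by move=> x Ix; rewrite adde_ge0 ?lee_fin ?u0 ?v0.
- by apply: emeasurable_funD; apply/measurable_EFinP.
rewrite ge0_integralD//; do ?exact/measurable_EFinP.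
have -> : (e%:E = 2%:E * ((e / 4)%:E + (e / 4)%:E))%E.
  by rewrite -EFinD -EFinM; congr (_%:E); field.
by rewrite lte_pmul2l// lteD.
Qed.

End approximation.

(** * The first expansion *)

Section expansion.
Context (a b c d : R) (a0 : 0 < a) (b0 : 0 < b) (c0 : 0 < c) (d0 : 0 < d).
Context (hac : a < 2 * c) (hbd : b < 2 * d).
Let w := beta_density a b.
Let f (x : R) := beta_density c d x / w x.

Let w_gt0 x : -1 < x < 1 -> 0 < w x.
Proof. exact: beta_density_gt0. Qed.

Let f_ge0 x : 0 <= f x.
Proof. by rewrite divr_ge0// beta_density_ge0. Qed.

Let continuous_f x : -1 < x < 1 -> {for x, continuous f}.
Proof.
move=> x1; apply: continuousM; first exact: continuous_beta_density.
apply: continuousV; first by rewrite gt_eqF// w_gt0.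
exact: continuous_beta_density.
Qed.

(** $h(\cdot|c,d)^2/h(\cdot|a,b)$ is a multiple of the beta density with parameters $2c-a$ and
    $2d-b$, positive by the two assumptions. *)
Let integrable_sqr : mu.-integrable I (fun x => (f x ^+ 2 * w x)%:E).
Proof.
have ca0 : 0 < 2 * c - a by rewrite subr_gt0.
have db0 : 0 < 2 * d - b by rewrite subr_gt0.
pose k r s : R := euler_beta r s * 2 `^ (r + s - 1).
have k0 r s : 0 < r -> 0 < s -> k r s != 0.
  by move=> r0 s0; rewrite gt_eqF// mulr_gt0 ?powR_gt0 ?euler_beta_gt0.
pose K := k a b * k (2 * c - a) (2 * d - b) / k c d ^+ 2.
apply: eq_integrable (integrableZl _ K (integrable_beta_density ca0 db0)) => //
  x.
rewrite inE /= in_itv /= => x1; rewrite -EFinM; congr (_%:E).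
have -> : f x ^+ 2 * w x = beta_density c d x ^+ 2 / w x.
  by rewrite /f; field; rewrite gt_eqF// w_gt0.
rewrite /w !beta_densityE// -!/(k _ _) /K; case/andP: x1 => x1 x2.
have y0 : 0 < x + 1 by rewrite -ltrBlDr sub0r.
have z0 : 0 < 1 - x by rewrite subr_gt0.
have pE (y r s : R) : 0 < y -> y `^ (2 * r - s - 1) = (y `^ (r - 1)) ^+ 2 / y
  `^ (s - 1).
  move=> {}y0; have -> : 2 * r - s - 1 = (r - 1) + (r - 1) - (s - 1) by ring.
  by rewrite powRB ?(gt_eqF y0) ?implybT// powRD ?(gt_eqF y0) ?implybT.
rewrite !pE//.
field; rewrite !k0// !gt_eqF// ?powR_gt0//.
Qed.

(** Expand the square: since $f w = h(\cdot|c,d)$, the cross term is a moment of $p$ and $f$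
    survives only in the constant $C = \int f^2 w$. *)
Let mean_square_error : exists C, forall p,
  (\int[mu]_(x in I) ((f x - p.[half_onem x]) ^+ 2 * w x)%:E
   = (C + (moment_fun a b (p ^+ 2) - 2 * moment_fun c d p))%:E)%E.
Proof.
exists (fine (\int[mu]_(x in I) (f x ^+ 2 * w x)%:E)%E) => p.
have i1 := integrable_poly_beta_density (p ^+ 2) a0 b0.
have i2 := integrable_poly_beta_density ((-2) *: p) c0 d0.
transitivity (\int[mu]_(x in I) ((f x ^+ 2 * w x)%:E +
   (((p ^+ 2).[(1 - x) / 2] * w x)%:E +
    (((-2) *: p).[(1 - x) / 2] * beta_density c d x)%:E)))%E.
  apply: eq_integral => x; rewrite inE /= in_itv /= => x1.
  rewrite -!EFinD; congr (_%:E).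
  have <- : f x * w x = beta_density c d x by rewrite divfK// gt_eqF// w_gt0.
  by rewrite horner_exp hornerZ /half_onem; ring.
rewrite integralD//; last exact: integrableD.
rewrite integralD// !integral_poly_beta_density//.
rewrite !EFinD fineK; last exact: integrable_fin_num.
by rewrite linearZ /= mulNr.
Qed.

Lemma jacobi_expansion : mean_square_sum (beta_density a b)
  (fun n x => conn0 n a b c d / jacobi_norm2 n a b * jacobi n a b x)
  (fun x => beta_density c d x / beta_density a b x).
Proof.
have [C CE] := mean_square_error.
pose S := jacobi_sum a b c d.
pose E p := C + (moment_fun a b (p ^+ 2) - 2 * moment_fun c d p).
have E_ge0 p : 0 <= E p.
  rewrite -lee_fin -CE integral_ge0// => x; rewrite /= in_itv /= => x1.
  by rewrite lee_fin mulr_ge0 ?(ltW (w_gt0 x1))//; exact: sqr_ge0.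
(* Positivity of the algebraic functional is read off from its integral form. *)
have sqr_ge0 p : 0 <= moment_fun a b (p ^+ 2).
  rewrite -lee_fin -integral_poly_beta_density// integral_ge0// => x.
  rewrite /= in_itv /= => x1; rewrite lee_fin horner_exp.
  by rewrite mulr_ge0 ?(ltW (w_gt0 x1))//; exact: sqr_ge0.
have E_min N p : (size p <= N)%N -> E (S N) <= E p.
  move=> pN; rewrite -subr_ge0.
  have -> : E p - E (S N) = moment_fun a b ((p - S N) ^+ 2).
    by rewrite -(moment_fun_jacobi_sum_sub c d a0 b0 pN) /E; ring.
  exact: sqr_ge0.
rewrite /mean_square_sum (_ : (fun N => _) = (fun N => (E (S N))%:E)).
  apply: cvg_EFin; first exact: nearW.
  apply/cvgrPdist_lt => e e0.
  have [p] := poly_dense_beta_density a0 b0 f_ge0 continuous_f e0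
    integrable_sqr.
  rewrite CE lte_fin => pe.
  (* By minimality a single good polynomial bounds the error of every partial sum with $N$ at least
     its size. *)
  exists (size p) => // N /= pN; rewrite sub0r normrN ger0_norm//.
  exact: le_lt_trans (E_min _ _ pN) pe.
apply/funext => N; rewrite -CE; apply: eq_integral => x _.
congr ((_ - _) ^+ 2 * _)%:E; rewrite /S /jacobi_sum horner_sum.
by apply: eq_bigr => n _; rewrite hornerZ jacobiE.
Qed.

End expansion.
End mean_square_approximation.

(** * The Legendre case and the second expansion *)

Lemma rising1 (R : realType) n : rising (1 : R) n = n`!%:R.
Proof.
elim: n => [|n IH]; first by rewrite rising0.
by rewrite risingSr IH factS mulnC natrM nat1r.
Qed.

(** Source of the factor $2n+1$ in the second expansion. *)
Lemma jacobi_norm2_legendre (R : realType) n :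
  jacobi_norm2 n (1 : R) 1 = (2 * n%:R + 1)^-1.
Proof.
case: n => [|n]; first by rewrite mulr0 add0r invr1.
have f0 m : m`!%:R != 0 :> R by rewrite pnatr_eq0 -lt0n fact_gt0.
have r2 : rising (1 + 1 : R) n = n.+1`!%:R.
  by rewrite -rising1 risingS mul1r.
rewrite /jacobi_norm2 !rising1 r2.
have -> : 1 + 1 + 2 * n.+1%:R - 1 = 2 * n.+1%:R + 1 :> R by ring.
have n0 : 2 * n.+1%:R + 1 != 0 :> R by rewrite gt_eqF// ltr_wpDl// mulr_ge0.
by set y := 2 * _ + 1 in n0 *; field; rewrite f0 n0.
Qed.

Lemma euler_beta11 (R : realType) : euler_beta (1 : R) 1 = 1.
Proof.
rewrite /euler_beta subrr.
under eq_Rintegral do rewrite !powRr0 mulr1.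
rewrite Rintegral_cst//= lebesgue_measure_itv /= lte_fin ltr01.
by rewrite oppr0 adde0 mulr1.
Qed.

(** The quotient has exponents $c-a$ and $d-b$, as has the density with parameters $c-a+1$, $d-b+1$;
    $h(\cdot|1,1)$ is the constant $1/2$. *)
Lemma beta_density_ratio (R : realType) (a b c d x : R) : 0 < a -> 0 < b ->
  0 < c -> 0 < d -> 0 < c - a + 1 -> 0 < d - b + 1 -> -1 < x < 1 ->
  beta_density c d x / beta_density a b x =
  euler_beta a b * euler_beta (c - a + 1) (d - b + 1) / euler_beta c d
  * (beta_density (c - a + 1) (d - b + 1) x / beta_density 1 1 x).
Proof.
move=> a0 b0 c0 d0 ca0 db0 x1; rewrite !beta_densityE// euler_beta11.
case/andP: x1 => x1 x2.
have y0 : 0 < x + 1 by rewrite -ltrBlDr sub0r.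
have z0 : 0 < 1 - x by rewrite subr_gt0.
have pB (y r s : R) : 0 < y -> y `^ (r - s) = y `^ r / y `^ s.
  by move=> {}y0; rewrite powRB// (gt_eqF y0) implybT.
have -> : 1 - 1 = 0 :> R by ring.
have -> : 1 + 1 - 1 = 1 :> R by ring.
rewrite !powRr0 powRr1//.
have -> : c - a + 1 - 1 = (c - 1) - (a - 1) by ring.
have -> : d - b + 1 - 1 = (d - 1) - (b - 1) by ring.
have -> : c - a + 1 + (d - b + 1) - 1 = 1 + (c + d - 1) - (a + b - 1) by ring.
rewrite (pB (x + 1) (c - 1))// (pB (1 - x) (d - 1))// (pB 2 (1 + _))//.
rewrite (@powRD _ 2 1 (c + d - 1)) ?pnatr_eq0 ?implybT// powRr1//.
have B0 r s : 0 < r -> 0 < s -> euler_beta r s != 0.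
  by move=> r0 s0; rewrite gt_eqF// euler_beta_gt0.
have p0 (y r : R) : 0 < y -> y `^ r != 0 by move=> {}y0;
  rewrite gt_eqF// powR_gt0.
(* Real powers and beta values are replaced by variables, leaving a rational identity for
   [field]. *)
have field_id (X X' Y Y' P Q B B1 B2 : R) : X' != 0 -> Y' != 0 -> P != 0 ->
    Q != 0 -> B != 0 -> B1 != 0 -> B2 != 0 ->
    X * Y / (B2 * P) / (X' * Y' / (B1 * Q)) =
    B1 * B / B2 * (X / X' * (Y / Y') / (B * (2 * P / Q)) / (1 * 1 / (1 * 2))).
  by move=> *; field; do !(apply/andP; split).
by apply: field_id; rewrite ?B0 ?p0.
Qed.

(** Scaling by $k$ multiplies each mean square error by $k^2$. *)
Lemma mean_square_sumZ (R : realType) (w : R -> R) (u : nat -> R -> R)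
    (f g : R -> R) (k : R) :
  measurable_fun (`]-1, 1[%classic : set R) w ->
  measurable_fun (`]-1, 1[%classic : set R) f ->
  (forall n, measurable_fun (`]-1, 1[%classic : set R) (u n)) ->
  (forall x, -1 < x < 1 -> 0 <= w x) ->
  (forall x, -1 < x < 1 -> g x = k * f x) ->
  mean_square_sum w u f -> mean_square_sum w (fun n x => k * u n x) g.
Proof.
move=> mw mf mu_ w0 gE h; rewrite /mean_square_sum.
pose D N x := (f x - \sum_(n < N) u n x) ^+ 2 * w x.
rewrite (_ : (fun N => _) = (fun N => ((k ^+ 2)%:E *
    \int[lebesgue_measure]_(x in `](-1)%R, 1%R[) (D N x)%:E)%E)).
  by rewrite -(mule0 (k ^+ 2)%:E); apply: cvgeZl.
apply/funext => N; rewrite -ge0_integralZl//.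
- apply: eq_integral => x; rewrite inE /= in_itv /= => x1; rewrite gE// -EFinM.
  by rewrite -mulr_sumr /D; congr (_%:E); ring.
- apply/measurable_EFinP; apply: measurable_funM => //; apply: measurable_funX.
  by apply: measurable_funB => //; apply: measurable_sum => i; exact: mu_.
- move=> x; rewrite /= in_itv /= => x1.
  by rewrite lee_fin mulr_ge0 ?w0//; exact: sqr_ge0.
- by rewrite lee_fin; exact: sqr_ge0.
Qed.

Lemma continuous_jacobi (R : realType) n (a b x : R) :
  {for x, continuous (jacobi n a b)}.
Proof.
rewrite (_ : jacobi n a b = fun y => (jacobi_poly n a b).[(1 - y) / 2]).
  exact: continuous_poly_half_onem.
by apply/funext => y; rewrite jacobiE.
Qed.

Theorem theorem2 (R : realType) (a b c d : R)
    (ha : 0 < a) (hb : 0 < b) (hc : 0 < c) (hd : 0 < d)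
    (hac : a < 2 * c) (hbd : b < 2 * d) :
  mean_square_sum (beta_density a b)
    (fun n x => conn0 n a b c d / jacobi_norm2 n a b * jacobi n a b x)
    (fun x => beta_density c d x / beta_density a b x)
  /\
  (1 < 2 * (c - a + 1) -> 1 < 2 * (d - b + 1) ->
   mean_square_sum (beta_density 1 1)
     (fun n x => euler_beta a b * euler_beta (c - a + 1) (d - b + 1)
        / euler_beta c d
        * ((2 * n%:R + 1) * conn0 n 1 1 (c - a + 1) (d - b + 1)
           * jacobi n 1 1 x))
     (fun x => beta_density c d x / beta_density a b x)).
Proof.
split; first exact: jacobi_expansion.
(* The premises are the square integrability conditions of the first expansion for
   $(1,1;c-a+1,d-b+1)$; they also make the new parameters positive. *)
move=> hc' hd'; have c0 : 0 < c - a + 1 by lra.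
have d0 : 0 < d - b + 1 by lra.
have h01 := @ltr01 R.
have den0 x : -1 < x < 1 -> 0 < beta_density 1 1 x :> R.
  exact: beta_density_gt0.
apply: (mean_square_sumZ (f := fun x =>
  beta_density (c - a + 1) (d - b + 1) x / beta_density 1 1 x)).
- exact: measurable_beta_density.
- apply: measurable_oo_continuous => x x1.
  apply: continuousM; first exact: continuous_beta_density.
  by apply: continuousV; [rewrite gt_eqF// den0|exact: continuous_beta_density].
- move=> n; apply: measurable_oo_continuous => x _.
  by apply: continuousM; [exact: cvg_cst|exact: continuous_jacobi].
- by move=> x x1; exact/ltW/den0.
- by move=> x x1; exact: beta_density_ratio.
have -> : (fun n x => (2 * n%:R + 1) * conn0 n 1 1 (c - a + 1) (d - b + 1)
      * jacobi n 1 1 x) =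
    (fun n x => conn0 n 1 1 (c - a + 1) (d - b + 1) / jacobi_norm2 n 1 1
      * jacobi n 1 1 x).
  apply/funext => n; apply/funext => x; rewrite jacobi_norm2_legendre invrK.
  by congr (_ * _); rewrite mulrC.
exact: jacobi_expansion.
Qed.
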